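(* Fix $\vartheta\ge1$. The sequence of random variables $(X^{(3)}_{n,\vartheta n}/n)_{n\in\mathbb{N}}$ satisfies the large deviations principle on $\mathbb{R}$ with speed $n$ and rate function $$ I_3(t;\vartheta)=\begin{cases} (t-1)\log\mu_2^{\leftarrow}(t)-\dfrac{1}{t+\mu_2^{\leftarrow}(t)}+(\vartheta-t)\log(\vartheta-t)+1-(\vartheta-1)\log\vartheta,& t\in(0,1),\\ (\vartheta-1)\log(\vartheta-1)+1-(\vartheta-1)\log\vartheta,& t=1,\\ +\infty,& t\notin(0,1], \end{cases} $$ with the convention $0\log 0=0$, where, for $t\in(0,1)$, $$\mu_2^{\leftarrow}(t)=\frac{t}{1+tW_0(-t^{-1}e^{-1/t})}-t.$$
   Context: $\genfrac{\{}{\}}{0pt}{}{n}{k}$ are the Stirling numbers of the second kind. For $n\in\mathbb{N}$ and $\theta$ a positive integer or a real number with $\theta>n-1$, the random variable $X^{(3)}_{n,\theta}$ has distribution $\mathbb{P}[X^{(3)}_{n,\theta}=k]=\genfrac{\{}{\}}{0pt}{}{n}{k}\frac{\theta(\theta-1)\cdots(\theta-k+1)}{\theta^n}$, $k\in\{1,\dots,n\}$. $W_0:(-1/e,\infty)\to(-1,\infty)$ is the principal real branch of the Lambert function, i.e. the inverse of $w\mapsto we^w$ on $(-1,\infty)$. (The function $\mu_2^{\leftarrow}$ is the inverse of the increasing bijection $\mu_2:(0,\infty)\to(0,1)$, $\mu_2(x)=1/W_0(1/x)-x$.) *)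

(* Defs.v *)
From HB Require Import structures.
From mathcomp Require Import all_boot all_order all_algebra.
From mathcomp Require Import all_classical all_reals all_analysis.
Set Implicit Arguments.
Unset Strict Implicit.
Unset Printing Implicit Defensive.
Import Order.TTheory GRing.Theory Num.Theory.
Import numFieldNormedType.Exports.
Local Open Scope classical_set_scope.
Local Open Scope ring_scope.

(* Number of partitions of an n-element set into k nonempty blocks;
   [finset.partition] excludes the empty block. *)
Definition stirling2 (n k : nat) : nat :=
  #|[set Q : {set {set 'I_n}} |
      finset.partition Q [set: 'I_n]%SET && (#|Q| == k)]%SET|.

Definition stirling2_law d (T : measurableType d) (R : realType)
    (P : probability T R) (X : {RV P >-> R}) (n : nat) (theta : R) : Prop :=
  forall k : nat, (1 <= k <= n)%N ->
    distribution P X [set k%:R] =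
    ((stirling2 n k)%:R * (\prod_(i < k) (theta - i%:R)) / theta ^+ n)%:E.

(* W_0 : the inverse of w |-> w e^w on (-1, +oo); values outside
   (-1/e, +oo) are junk. *)
Definition lambertW0 (R : realType) : R -> R :=
  pinv [set w : R | -1 < w] (fun w => w * expR w).

Definition mu2 (R : realType) (x : R) : R := 1 / lambertW0 (1 / x) - x.

(* The inverse of mu2 on (0, +oo); values outside (0, 1) are junk. *)
Definition mu2_inv (R : realType) : R -> R :=
  pinv [set x : R | 0 < x] (@mu2 R).

(* The library's [ln 0] is a real number, so x * ln x = 0 at x = 0, which is
   the convention 0 log 0 = 0. *)
Definition I3 (R : realType) (vtheta t : R) : \bar R :=
  if 0 < t < 1 then
    ((t - 1) * ln (mu2_inv t) - 1 / (t + mu2_inv t)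
     + (vtheta - t) * ln (vtheta - t) + 1 - (vtheta - 1) * ln vtheta)%:E
  else if t == 1 then
    ((vtheta - 1) * ln (vtheta - 1) + 1 - (vtheta - 1) * ln vtheta)%:E
  else +oo%E.

Definition rate_function (R : realType) (I : R -> \bar R) : Prop :=
  (forall t, (0 <= I t)%E) /\ lower_semicontinuous I.

(* Large deviations principle on R, each variable living on its own
   probability space. [lne 0 = -oo] and [ereal_inf set0 = +oo]. *)
Definition satisfies_LDP (R : realType) (d : nat -> measure_display)
    (T : forall n, measurableType (d n)) (P : forall n, probability (T n) R)
    (Y : forall n, {RV (P n) >-> R}) (speed : nat -> R) (I : R -> \bar R)
    : Prop :=
  [/\ rate_function I,
      speed n @[n --> \oo] --> +oo%R,
      forall U : set R, open U ->
        (- ereal_inf (I @` U) <=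
         limn_einf (fun n =>
           (speed n)^-1%:E * lne (distribution (P n) (Y n) U)))%E &
      forall F : set R, closed F ->
        (limn_esup (fun n =>
           (speed n)^-1%:E * lne (distribution (P n) (Y n) F)) <=
         - ereal_inf (I @` F))%E].

(* Main.v *)
Require Import Defs.
From HB Require Import structures.
From mathcomp Require Import all_boot.
Set Implicit Arguments.
Unset Strict Implicit.
Unset Printing Implicit Defensive.

                                                 

(** The mass at k is S(n,k) (vtheta n)_k / (vtheta n)^n, where (x)_k is the falling factorial. There
    are only n atoms, so everything reduces to the exponential order of this mass, up to polynomial
    factors, when k/n is near t. Comparing sums of logarithms with integrals settles the falling
    factorial ([falling_ge], [falling_le]); the Stirling number needs two matching bounds.

    Upper bound: S(n,k) k!/n! is the coefficient of r^n in (e^r - 1)^k, hence at most (e^r - 1)^k /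
    r^n for every r > 0 ([stirling2_egf_le], [stirling2_prob_le]). The stationary r is the w > 0
    with 1 - e^(-w) = t w ([saddle]).

    Lower bound: for an integer m, S(n,k) (m)_k / m^n is the probability that n balls thrown
    uniformly into m boxes occupy exactly k of them. Two moments and Chebyshev give some k close to
    m - m (1 - 1/m)^n whose probability is at least 1/(2(n+1)) ([occupancy_typical]). With m close
    to n/w this k satisfies k/n -> (1 - e^(-w))/w = t, and passing from m to vtheta n only changes
    falling factorials ([stirling2_prob_ge], [stirling2_prob_lower]).

    By [falling_exp_saddle] the two exponents agree at w, and since the inverse of mu2 at t is
    e^(-w)/w, the common value is the rate ([I3_saddle]). At t = 1 one takes k = n, where S(n,n) =
    1.

    The properties of the rate come from the same estimates: masses are at most 1, so [I3] is
    nonnegative; the lower bound cannot exceed the upper one for any r, so [I3] dominates a family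
    of continuous functions ([le_I3]), and this gives lower semicontinuity. Closed sets are then
    handled by a union bound over the atoms, open sets by a single atom. *)

Definition kpartitions (T : finType) (A : {set T}) (k : nat) :
    {set {set {set T}}} :=
  [set Q : {set {set T}} | partition Q A && (#|Q| == k)].

(** * Set partitions and the Stirling recurrence *)

Section PartitionRecurrence.
Variables (T : finType) (A : {set T}) (x : T).
Hypothesis xA : x \notin A.
Implicit Types (Q : {set {set T}}) (B : {set T}).

Let add_block Q := [set x] |: Q.
Let add_elt (QB : {set {set T}} * {set T}) := (x |: QB.2) |: (QB.1 :\ QB.2).

Let not_in_block Q B : partition Q A -> B \in Q -> x \notin B.
Proof. by move=> pQ BQ; apply: contra xA; apply/subsetP/(partitionS pQ). Qed.

Let setU1_notin Q B : partition Q A -> x |: B \notin Q.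
Proof.
by move=> pQ; apply/negP => /(not_in_block pQ); rewrite setU11.
Qed.

Let set1_notin Q : partition Q A -> [set x] \notin Q.
Proof. by move=> /(setU1_notin set0); rewrite setU0. Qed.

Let add_block_partition Q : partition Q A -> partition (add_block Q) (x |: A).
Proof.
move=> pQ; apply: partitionU1 => //; last by rewrite disjoints1.
by apply/set0Pn; exists x; rewrite set11.
Qed.

Let add_elt_partition Q B :
  partition Q A -> B \in Q -> partition (add_elt (Q, B)) (x |: A).
Proof.
move=> pQ BQ.
have -> : x |: A = (x |: B) :|: (A :\: B).
  by rewrite -setUA -{1}(setID A B) (setIidPr (partitionS pQ BQ)).
apply: partitionU1; first exact: partitionD1.
  by apply/set0Pn; exists x; rewrite setU11.
rewrite disjoints_subset; apply/subsetP => y; rewrite !inE.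
by case/predU1P => [->|->]; rewrite ?(negbTE xA) ?andbF.
Qed.

Let add_block_inj k : {in kpartitions A k &, injective add_block}.
Proof.
move=> Q Q'; rewrite !inE => /andP[pQ _] /andP[pQ' _] e.
rewrite -(setU1K (set1_notin pQ)) -(setU1K (set1_notin pQ')).
by rewrite -/(add_block _) e.
Qed.

Let blocks k : {set {set {set T}} * {set T}} :=
  [set QB | (QB.1 \in kpartitions A k) && (QB.2 \in QB.1)].

Let add_elt_inj k : {in blocks k &, injective add_elt}.
Proof.
move=> [Q B] [Q' B']; rewrite !inE /= => /andP[/andP[pQ _] BQ].
move=> /andP[/andP[pQ' _] BQ'] e.
have xB := not_in_block pQ BQ; have xB' := not_in_block pQ' BQ'.
have eB : x |: B = x |: B'.
  have : x |: B \in add_elt (Q', B') by rewrite -e setU11.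
  rewrite inE => /orP[/set1P //|]; rewrite inE => /andP[_ h].
  by move: (setU1_notin B pQ'); rewrite h.
have {}eB : B = B' by rewrite -(setU1K xB) eB setU1K.
rewrite -eB in e BQ' *.
have nU P : partition P A -> x |: B \notin P :\ B.
  by move=> pP; rewrite inE (negbTE (setU1_notin B pP)) andbF.
rewrite -(setD1K BQ) -(setD1K BQ') -(setU1K (nU Q pQ)) -(setU1K (nU Q' pQ')).
by rewrite /add_elt /= in e; rewrite e.
Qed.

(** Inspect the block containing [x]: either it is the singleton, and removing it leaves a partition
    of [A] with one block fewer, or deleting [x] from it leaves a nonempty block [B] of a partition
    of [A] with equally many blocks. *)
Lemma kpartitionsU1 k : kpartitions (x |: A) k.+1 =
  add_block @: kpartitions A k :|: add_elt @: blocks k.+1.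
Proof.
apply/setP => Q; rewrite in_setU; apply/idP/orP; last first.
  case=> /imsetP[].
    move=> Q'; rewrite !inE => /andP[pQ' /eqP sQ'] ->.
    by rewrite add_block_partition //= cardsU1 set1_notin // sQ'.
  move=> [Q' B]; rewrite !inE /= => /andP[/andP[pQ' /eqP sQ'] BQ'] ->.
  rewrite add_elt_partition // cardsU1 inE (negbTE (setU1_notin B pQ')) andbF.
  by rewrite /= -sQ' [in X in _ == X](cardsD1 B) BQ'.
rewrite inE => /andP[pQ /eqP sQ].
have xQ : x \in cover Q by rewrite (cover_partition pQ) setU11.
set C := pblock Q x; have CQ : C \in Q := pblock_mem xQ.
have xC : x \in C by rewrite mem_pblock.
have sD : #|Q :\ C| = k.
  by apply/eqP; rewrite -eqSS -sQ [X in _ == X](cardsD1 C) CQ.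
have pD := partitionD1 pQ CQ.
have [CE|CN] := eqVneq (C :\ x) set0.
  have C1 : C = [set x] by rewrite -(setD1K xC) CE setU0.
  left; apply/imsetP; exists (Q :\ C); last by rewrite /add_block -C1 setD1K.
  by rewrite inE sD eqxx andbT; move: pD; rewrite C1 setU1K.
right; set B := C :\ x.
have sBA : B \subset A.
  rewrite subDset; apply: partitionS pQ CQ.
have DE : (x |: A) :\: C = A :\: B.
  apply/setP => y; rewrite !inE; case: (eqVneq y x) => [->|_] //=.
  by rewrite xC (negbTE xA).
have pB : partition (B |: (Q :\ C)) A.
  rewrite -(setID A B) (setIidPr sBA) -DE.
  apply: partitionU1 => //; rewrite DE disjoints_subset.
  by apply/subsetP => y yB; rewrite !inE in yB *; rewrite yB.
(* [B] must be a new block: otherwise the block count would drop and removing [B] again would not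
   return [Q :\ C]. *)
have BN : B \notin Q :\ C.
  apply/negP => /(partitionS pD) BS; case/set0Pn: CN => y yB.
  by have := subsetP BS y yB; rewrite DE inE yB.
apply/imsetP; exists (B |: (Q :\ C), B).
  by rewrite !inE /= eqxx pB cardsU1 BN sD add1n eqxx.
by rewrite /add_elt /= setU1K // setD1K // setD1K.
Qed.

(** The two families are disjoint because only the first has [[set x]] as a block; in the second,
    [x] can join any of the [k.+1] blocks. *)
Lemma card_kpartitionsU1 k : #|kpartitions (x |: A) k.+1| =
  #|kpartitions A k| + k.+1 * #|kpartitions A k.+1|.
Proof.
rewrite kpartitionsU1 cardsU (_ : _ :&: _ = set0); last first.
  apply/setP => Q; rewrite !inE; apply/negbTE/negP => /andP[].
  case/imsetP => Q1 _ -> /imsetP[[Q2 B]]; rewrite !inE /=.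
  move=> /andP[/andP[pQ _] BQ] e.
  have : [set x] \in add_elt (Q2, B) by rewrite -e setU11.
  rewrite !inE (negbTE (set1_notin pQ)) andbF orbF => /eqP/setP eB.
  have /set0Pn[y yB] := partition_neq0 pQ BQ.
  have := eB y; rewrite !inE yB orbT => /eqP yx.
  by move: (not_in_block pQ BQ); rewrite -yx yB.
rewrite cards0 subn0 (card_in_imset (@add_block_inj k)).
rewrite (card_in_imset (@add_elt_inj k.+1)); congr (_ + _).
rewrite -sum1_card (eq_bigl (fun QB => (QB.1 \in kpartitions A k.+1) &&
  (QB.2 \in QB.1))); last by move=> QB; rewrite inE.
rewrite -(pair_big_dep (mem (kpartitions A k.+1)) (fun Q B => B \in Q)
  (fun _ _ => 1)) /=.
rewrite (eq_bigr (fun=> k.+1)); first by rewrite sum_nat_const mulnC.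
by move=> Q; rewrite inE => /andP[_ /eqP sQ]; rewrite sum1_card.
Qed.

End PartitionRecurrence.

Lemma kpartitionsn0 (T : finType) (A : {set T}) :
  #|kpartitions A 0| = (A == set0).
Proof.
have -> : kpartitions A 0 = if A == set0 then [set set0] else set0.
  apply/setP => Q; rewrite inE cards_eq0; case: (eqVneq A set0) => [->|A0].
    by rewrite partition_set0 andbb inE.
  rewrite inE; apply/negbTE/negP => /andP[pQ /eqP Q0].
  by case/eqP: A0; rewrite -(cover_partition pQ) Q0 /cover big_set0.
by case: ifP; rewrite ?cards1 ?cards0.
Qed.

Lemma kpartitions0n (T : finType) k : #|kpartitions (@set0 T) k.+1| = 0.
Proof.
apply/eqP; rewrite cards_eq0; apply/eqP/setP => Q; rewrite !inE.
by rewrite partition_set0; apply/negbTE/andP => -[/eqP->]; rewrite cards0.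
Qed.

(** Both sides obey the same recurrence, so removing one point from each set gives an induction and
    no bijection has to be transported. This identifies ['I_n.+1] minus a point with ['I_n]. *)
Lemma card_kpartitions_eq (T U : finType) (A : {set T}) (B : {set U}) k :
  #|A| = #|B| -> #|kpartitions A k| = #|kpartitions B k|.
Proof.
have [n nA] : exists n, #|A| = n by exists #|A|.
elim: n A B nA k => [|n IH] A B nA k AB.
  have := esym AB; rewrite nA => /cards0_eq ->; rewrite (cards0_eq nA).
  by case: k => [|k]; rewrite ?kpartitions0n ?kpartitionsn0 ?eqxx.
have [x xA] : exists x, x \in A by apply/card_gt0P; rewrite nA.
have [y yB] : exists y, y \in B by apply/card_gt0P; rewrite -AB nA.
have xA' : x \notin A :\ x by rewrite setD11.
have yB' : y \notin B :\ y by rewrite setD11.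
have nA' : #|A :\ x| = n by move: nA; rewrite (cardsD1 x) xA => -[].
have AB' : #|A :\ x| = #|B :\ y|.
  by move: AB; rewrite (cardsD1 x) xA [in RHS](cardsD1 y) yB => -[].
rewrite -(setD1K xA) -(setD1K yB); case: k => [|k].
  rewrite !kpartitionsn0; congr (nat_of_bool _).
  have neq0 (V : finType) (z : V) C : (z |: C == set0) = false.
    by apply/negbTE/set0Pn; exists z; rewrite setU11.
  by rewrite !neq0.
by rewrite !card_kpartitionsU1// !(IH _ (B :\ y)).
Qed.

Lemma card_kpartitions_ord0 k : #|kpartitions [set: 'I_0] k| = (k == 0).
Proof.
have -> : [set: 'I_0] = set0 by apply/setP => -[].
by case: k => [|k]; rewrite ?kpartitions0n ?kpartitionsn0 ?eqxx.
Qed.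

Lemma card_kpartitions_ordn0 n : #|kpartitions [set: 'I_n.+1] 0| = 0.
Proof.
rewrite kpartitionsn0; case: eqP => // /setP/(_ ord0).
by rewrite !inE.
Qed.

Lemma card_kpartitions_ordS n k : #|kpartitions [set: 'I_n.+1] k.+1| =
  #|kpartitions [set: 'I_n] k| + k.+1 * #|kpartitions [set: 'I_n] k.+1|.
Proof.
pose A := [set~ (ord0 : 'I_n.+1)].
have nA : #|A| = #|[set: 'I_n]| by rewrite cardsC1 cardsT !card_ord.
rewrite -(setUCr [set ord0]) card_kpartitionsU1; last by rewrite !inE eqxx.
by rewrite !(card_kpartitions_eq _ nA).
Qed.

From mathcomp Require Import all_order all_algebra.
From mathcomp Require Import all_classical all_reals all_analysis measurable_realfun.
From mathcomp Require Import ring lra.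
Import Order.TTheory GRing.Theory Num.Theory.
Import numFieldNormedType.Exports.

                                            

(** * Stirling numbers and falling factorials *)

Lemma stirling2_0n k : stirling2 0 k = (k == 0).
Proof. exact: card_kpartitions_ord0. Qed.

Lemma stirling2_n0 n : stirling2 n.+1 0 = 0.
Proof. exact: card_kpartitions_ordn0. Qed.

Lemma stirling2S n k :
  stirling2 n.+1 k.+1 = stirling2 n k + k.+1 * stirling2 n k.+1.
Proof. exact: card_kpartitions_ordS. Qed.

Lemma stirling2_small n k : n < k -> stirling2 n k = 0.
Proof.
elim: n k => [|n IH] [|k]//; first by rewrite stirling2_0n.
by rewrite ltnS => nk; rewrite stirling2S !IH ?muln0// ltnW.
Qed.

Lemma stirling2_nn n : stirling2 n n = 1.
Proof.
elim: n => [|n IH]; first by rewrite stirling2_0n.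
by rewrite stirling2S IH stirling2_small// muln0.
Qed.

Local Open Scope classical_set_scope.
Local Open Scope ring_scope.

Definition falling (R : pzRingType) (x : R) (k : nat) : R :=
  \prod_(i < k) (x - i%:R).

Lemma fallingS (R : pzRingType) (x : R) k :
  falling x k.+1 = falling x k * (x - k%:R).
Proof. by rewrite /falling big_ord_recr. Qed.

Lemma fallingSl (R : comPzRingType) (x : R) k :
  falling x k.+1 = x * falling (x - 1) k.
Proof.
rewrite /falling big_ord_recl subr0; congr (_ * _); apply: eq_bigr => i _.
by rewrite /bump/= natrD opprD addrA.
Qed.

(** Follows from x (x)_k = (x)_(k+1) + k (x)_k and the recurrence. It says that the masses of the
    law add up to 1, and the occupancy moments are derived from it. *)
Lemma sum_stirling2_falling (R : comPzRingType) (x : R) n :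
  \sum_(k < n.+1) (stirling2 n k)%:R * falling x k = x ^+ n.
Proof.
elim: n => [|n IH].
  by rewrite big_ord1 stirling2_0n mul1r /falling big_ord0.
rewrite big_ord_recl stirling2_n0 mul0r add0r.
rewrite (eq_bigr (fun i : 'I_n.+1 => (stirling2 n i)%:R * falling x i * x -
    (stirling2 n i)%:R * falling x i * i%:R +
    (stirling2 n i.+1)%:R * falling x i.+1 * i.+1%:R)); last first.
  move=> i _; rewrite /bump/= stirling2S natrD natrM mulrDl; congr (_ + _).
    by rewrite fallingS -mulrBr mulrA.
  by rewrite -mulrA mulrC.
rewrite big_split/= sumrB.
(* Index shift: the first term on the right has weight 0, and the last one on the left contains S(n,
   n+1) = 0. *)
have -> : \sum_(i < n.+1) (stirling2 n i.+1)%:R * falling x i.+1 * i.+1%:R =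
  \sum_(i < n.+1) (stirling2 n i)%:R * falling x i * i%:R.
  rewrite [in RHS]big_ord_recl mulr0 add0r [in LHS]big_ord_recr/=.
  by rewrite stirling2_small// !mul0r addr0.
by rewrite subrK -mulr_suml IH exprSr.
Qed.

(** * Generating-function upper bound *)

Section StirlingUpperBound.
Variable R : realType.
Implicit Types (x r : R) (n k : nat).

(** The coefficient of r^n in the power series of (e^r - 1)^k. *)
Let a n k : R := (stirling2 n k)%:R * k`!%:R / n`!%:R.

Let aS n k : n.+1%:R * a n.+1 k.+1 = k.+1%:R * (a n k.+1 + a n k).
Proof.
rewrite /a stirling2S !factS !natrM natrD natrM.
have n1 : n.+1%:R != 0 :> R by rewrite pnatr_eq0.
have nf : n`!%:R != 0 :> R by rewrite pnatr_eq0 -lt0n fact_gt0.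
by field; rewrite nf addrC natr1 n1.
Qed.

                                                                               
                                                                         
(** A single term of a nonnegative series is at most its sum. Series are avoided by induction on
    [n]: the difference of the two sides vanishes at 0, and its derivative is nonnegative by the
    recurrence [aS] and the induction hypothesis. *)
Lemma stirling2_egf_le n k r : 0 <= r ->
  (stirling2 n k)%:R * k`!%:R / n`!%:R * r ^+ n <= (expR r - 1) ^+ k.
Proof.
rewrite -/(a n k); elim: n k r => [|n IH] k r r0.
  rewrite expr0 mulr1 /a stirling2_0n fact0 divr1; case: k => [|k] /=.
    by rewrite mul1r fact0 expr0.
  by rewrite !mul0r exprn_ge0// subr_ge0 -expR0 ler_expR.
case: k => [|k]; first by rewrite /a stirling2_n0 !mul0r expr0.
pose g x := (expR x - 1) ^+ k.+1 - a n.+1 k.+1 * x ^+ n.+1.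
pose dg x := k.+1%:R * ((expR x - 1) ^+ k * expR x) -
  a n.+1 k.+1 * (n.+1%:R * x ^+ n).
have dgE x : is_derive x 1 g (dg x).
  have -> : g = (expR - cst 1) ^+ k.+1 - a n.+1 k.+1 *: (id ^+ n.+1 : R -> R).
    by apply/funext => y; rewrite /g !fctE.
  apply: is_derive_eq; rewrite /GRing.scale/= subr0 !fctE.
  by rewrite /dg mulr1 !mulrA.
have dgE' x : derive1 g x = dg x.
  by rewrite derive1E; apply: (@derive_val _ _ _ _ _ _ _ (dgE x)).
suff : g 0 <= g r by rewrite /g expR0 subrr !expr0n/= mulr0 subr0 subr_ge0.
apply: (@ger0_derive1_ndecry _ _ 0) => //.
- move=> x; rewrite in_itv/= andbT => /ltW x0; rewrite dgE' /dg.
  have -> : a n.+1 k.+1 * (n.+1%:R * x ^+ n) =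
    k.+1%:R * (a n k.+1 * x ^+ n + a n k * x ^+ n).
    by rewrite mulrA (mulrC (a _ _)) aS; ring.
  rewrite -mulrBr mulr_ge0// subr_ge0.
  (* Uses e^x (e^x - 1)^k = (e^x - 1)^(k+1) + (e^x - 1)^k, each summand being bounded below by the
     induction hypothesis. *)
  have := IH k.+1 x x0; have := IH k x x0; rewrite exprS => h1 h2.
  apply: le_trans (lerD h2 h1) _; rewrite le_eqVlt; apply/orP; left.
  by apply/eqP; ring.
- apply: derivable_within_continuous => x _.
  by have [] := dgE x.
Qed.

End StirlingUpperBound.

(** * Falling factorials against integrals of the logarithm *)

Section FallingBounds.
Variable R : realType.
Implicit Types (x y t : R) (n k : nat).

                                                                      
(** An antiderivative of ln; as the library has [ln 0 = 0], it takes its limit value 0 at 0. *)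
Definition xlnx x : R := x * ln x - x.

Lemma xlnx0 : xlnx 0 = 0. Proof. by rewrite /xlnx mul0r subr0. Qed.

Lemma xlnxM x y : 0 < x -> 0 <= y -> xlnx (x * y) = x * xlnx y + x * y * ln x.
Proof.
rewrite le_eqVlt /xlnx => x0 /predU1P[<-|y0].
  by rewrite !(mulr0,mul0r,subr0,addr0).
by rewrite lnM//; ring.
Qed.

(** The concave ln lies below its tangent at [x]. This replaces integration in the comparisons that
    follow. *)
Lemma ln_sub_le x y : 0 < x -> 0 < y -> x * (ln y - ln x) <= y - x.
Proof.
move=> x0 y0; rewrite -ln_div// -ler_pdivlMl//.
have -> : ln (y / x) = ln (1 + (y / x - 1)) by rewrite addrC subrK.
have -> : x^-1 * (y - x) = y / x - 1 by field; rewrite gt_eqF.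
by apply: le_ln1Dx; rewrite ltrBrDl subrr divr_gt0.
Qed.

(** The left side is the integral of ln over [x-1, x], where ln x is the maximum. *)
Lemma xlnxB1_le_ln x : 1 <= x -> xlnx x - xlnx (x - 1) <= ln x.
Proof.
rewrite le_eqVlt => /predU1P[<-|x1].
  by rewrite subrr xlnx0 subr0 /xlnx ln1 mulr0 sub0r lerN10.
have x0 : 0 < x by exact: lt_trans x1.
have := @ln_sub_le (x - 1) x; rewrite subr_gt0 => /(_ x1 x0); rewrite /xlnx.
by rewrite !mulrBl !mulrBr !mul1r; lra.
Qed.

Lemma ln_le_xlnxD1 x : 0 < x -> ln x <= xlnx (x + 1) - xlnx x.
Proof.
move=> x0; have x1 : 0 < x + 1 by rewrite addr_gt0.
have := @ln_sub_le (x + 1) x x1 x0; rewrite /xlnx.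
by rewrite !mulrBr !mulrDl !mul1r; lra.
Qed.

Lemma xlnxD1_ge x : 0 <= x -> xlnx x - 1 <= xlnx (x + 1).
Proof.
rewrite le_eqVlt => /predU1P[<-|x0].
  by rewrite add0r xlnx0 /xlnx ln1 mulr0 lexx.
have l1 : 0 <= ln (x + 1) by rewrite ln_ge0// lerDr ltW.
have x1 : 0 < x + 1 by rewrite addr_gt0.
have : 0 <= x * (ln (x + 1) - ln x).
  by rewrite mulr_ge0 ?(ltW x0)// subr_ge0 ler_ln// lerDl.
by rewrite /xlnx mulrBr mulrDl mul1r; lra.
Qed.

Lemma falling_ge0 x k : k%:R <= x -> 0 <= falling x k.
Proof.
move=> kx; rewrite prodr_ge0// => i _; rewrite subr_ge0 (le_trans _ kx)//.
by rewrite ler_nat ltnW.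
Qed.

Lemma falling_ge x k :
  k%:R <= x -> expR (xlnx x - xlnx (x - k%:R)) <= falling x k.
Proof.
elim: k => [|k IH] kx; first by rewrite subr0 subrr expR0 /falling big_ord0.
have kx' : k%:R <= x by rewrite (le_trans _ kx)// ler_nat.
have b1 : 1 <= x - k%:R by rewrite lerBrDl natr1.
have -> : xlnx x - xlnx (x - k.+1%:R) = xlnx x - xlnx (x - k%:R) +
  (xlnx (x - k%:R) - xlnx (x - k%:R - 1)).
  have -> : x - k.+1%:R = x - k%:R - 1 by rewrite -natr1; ring.
  by ring.
rewrite expRD fallingS ler_pM ?expR_ge0//; first exact: IH.
rewrite -[leRHS]lnK; last by rewrite posrE (lt_le_trans _ b1).
by rewrite ler_expR xlnxB1_le_ln.
Qed.

(** The top factor [x] is set apart so that each of x-1, ..., x-k can be compared with ln on the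
    unit interval to its right, all of them inside [x-k, x]. *)
Lemma fallingS_le x k :
  k%:R <= x -> falling x k.+1 <= x * expR (xlnx x - xlnx (x - k%:R)).
Proof.
elim: k => [|k IH] kx.
  by rewrite fallingS subr0 subrr expR0 /falling big_ord0 mul1r mulr1.
have kx' : k%:R <= x by rewrite (le_trans _ kx)// ler_nat.
have x0 : 0 <= x by rewrite (le_trans _ kx').
have -> : xlnx x - xlnx (x - k.+1%:R) = xlnx x - xlnx (x - k%:R) +
  (xlnx (x - k.+1%:R + 1) - xlnx (x - k.+1%:R)).
  have -> : x - k.+1%:R + 1 = x - k%:R by rewrite -natr1; ring.
  by ring.
rewrite expRD mulrA fallingS ler_pM ?falling_ge0 ?subr_ge0//; first exact: IH.
have : 0 <= x - k.+1%:R by rewrite subr_ge0.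
rewrite le_eqVlt => /predU1P[b0|b0].
  by rewrite -[leLHS]b0 expR_ge0.
by rewrite -[leLHS]lnK// ler_expR ln_le_xlnxD1.
Qed.

(** Realigns the index in [fallingS_le]; by [xlnxD1_ge] the shift costs at most a factor e. *)
Lemma falling_le x k : 1 <= x -> k%:R <= x ->
  falling x k <= x * expR (1 + (xlnx x - xlnx (x - k%:R))).
Proof.
case: k => [|k] x1 kx.
  rewrite subr0 subrr addr0 /falling big_ord0 -[leLHS]mulr1 ler_pM//.
  by rewrite -expR0 ler_expR.
have x0 : 0 <= x by rewrite (le_trans _ x1).
have kx' : k%:R <= x by rewrite (le_trans _ kx)// ler_nat.
apply: le_trans (fallingS_le kx') _; rewrite ler_wpM2l// ler_expR.
have := @xlnxD1_ge (x - k.+1%:R); rewrite subr_ge0 => /(_ kx).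
have -> : x - k.+1%:R + 1 = x - k%:R by rewrite -natr1; ring.
by lra.
Qed.

Lemma falling_nn n : falling (n%:R : R) n = n`!%:R.
Proof.
elim: n => [|n IH]; first by rewrite /falling big_ord0.
by rewrite fallingSl -natr1 addrK IH natr1 -natrM factS.
Qed.

Lemma fact_le n : (0 < n)%N -> n`!%:R <= n%:R * expR (1 + xlnx n%:R) :> R.
Proof.
move=> n0; rewrite -falling_nn; apply: le_trans (falling_le _ _) _ => //.
  by rewrite ler1n.
by rewrite subrr xlnx0 subr0.
Qed.

Lemma fact_ge n : expR (xlnx n%:R) <= n`!%:R :> R.
Proof.
by rewrite -falling_nn (le_trans _ (falling_ge _))// subrr xlnx0 subr0.
Qed.

End FallingBounds.

                                   

(** * Balls in boxes: the typical number of occupied boxes *)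

Section Occupancy.
Variables (R : realType) (m n : nat).
Implicit Types (x : R) (k : nat).

Lemma falling_nat_small k : (m < k)%N -> falling (m%:R : R) k = 0.
Proof.
by move=> mk; rewrite /falling (bigD1 (Ordinal mk))//= subrr mul0r.
Qed.

Lemma falling_nat_ge0 k : 0 <= falling (m%:R : R) k.
Proof.
have [km|mk] := leqP k m; first by rewrite falling_ge0// ler_nat.
by rewrite falling_nat_small.
Qed.

(** Divided by x^n, this is the mean number of vacant boxes; it rests on (x)_k (x-k) = x (x-1)_k. *)
Lemma sum_stirling2_falling_vacant x :
  \sum_(k < n.+1) (stirling2 n k)%:R * falling x k * (x - k%:R) =
  x * (x - 1) ^+ n.
Proof.
rewrite -sum_stirling2_falling mulr_sumr; apply: eq_bigr => k _.
by rewrite -mulrA -fallingS fallingSl mulrCA.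
Qed.

(** The second factorial moment of the number of vacant boxes, likewise times x^n. *)
Lemma sum_stirling2_falling_vacant2 x :
  \sum_(k < n.+1) (stirling2 n k)%:R * falling x k *
    ((x - k%:R) * (x - k%:R - 1)) = x * (x - 1) * (x - 2) ^+ n.
Proof.
rewrite -sum_stirling2_falling mulr_sumr; apply: eq_bigr => k _.
rewrite mulrA -(mulrA _ (falling x k)) -fallingS -mulrA.
have -> : falling x k.+1 * (x - k%:R - 1) = falling x k.+2.
  by rewrite [RHS]fallingS -[k.+1%:R]natr1 opprD addrA.
rewrite !fallingSl (_ : x - 1 - 1 = x - 2); last by ring.
by ring.
Qed.

Let x : R := m%:R.
                                      
Let mu : R := x * (x - 1) ^+ n / x ^+ n.

(** With V the number of vacant boxes, Var V = E[V(V-1)] + mu - mu^2. Since x(x-2) <= (x-1)^2,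
    E[V(V-1)] <= mu^2, so the variance is at most mu <= x. Everything is kept multiplied by x^n. *)
Lemma occupancy_variance : (1 < m)%N ->
  \sum_(k < n.+1) (stirling2 n k)%:R * falling x k * (x - k%:R - mu) ^+ 2 <=
  x * x ^+ n.
Proof.
move=> m1; have x2 : 2 <= x by rewrite ler_nat.
have x0 : 0 < x by rewrite (lt_le_trans _ x2).
have xn0 : 0 < x ^+ n by rewrite exprn_gt0.
have muE : mu * x ^+ n = x * (x - 1) ^+ n by rewrite divfK ?gt_eqF.
have -> : \sum_(k < n.+1)
    (stirling2 n k)%:R * falling x k * (x - k%:R - mu) ^+ 2 =
  x * (x - 1) * (x - 2) ^+ n + (1 - 2 * mu) * (x * (x - 1) ^+ n) +
  mu ^+ 2 * x ^+ n.
  rewrite -sum_stirling2_falling_vacant2 -sum_stirling2_falling_vacant.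
  rewrite -(sum_stirling2_falling x n) !mulr_sumr -!big_split/=.
  by apply: eq_bigr => k _; ring.
have mux : mu * x ^+ n <= x * x ^+ n.
  rewrite muE ler_wpM2l ?(ltW x0)// lerXn2r ?nnegrE; lra.
rewrite -muE (_ : _ + _ + _ = mu * x ^+ n +
  (x * (x - 1) * (x - 2) ^+ n - mu ^+ 2 * x ^+ n)); last by ring.
rewrite -[leRHS]addr0 lerD// subr_le0 -(ler_pM2r xn0).
have -> : mu ^+ 2 * x ^+ n * x ^+ n = x ^+ 2 * (x - 1) ^+ 2 ^+ n.
  by rewrite exprAC -exprMn -muE; ring.
rewrite -(mulrA (x * (x - 1))) -exprMn (expr2 x) ler_pM//.
- by rewrite mulr_ge0; lra.
- by rewrite exprn_ge0// mulr_ge0; lra.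
- by rewrite ler_wpM2l; lra.
- by rewrite lerXn2r ?nnegrE ?sqr_ge0// ?mulr_ge0; nra.
Qed.

(** By Chebyshev, at least half of the mass lies within [delta] of the mean; by pigeonhole one of
    the at most n+1 values there carries a 1/(2(n+1)) share. *)
Lemma occupancy_typical (delta : R) : (1 < m)%N -> 0 < delta ->
  2 * x <= delta ^+ 2 ->
  exists k, [/\ (k <= n)%N, (k <= m)%N, `|k%:R - (x - mu)| <= delta &
    x ^+ n <= 2 * n.+1%:R * ((stirling2 n k)%:R * falling x k)].
Proof.
move=> m1 d0 xd; have x0 : 0 < x by rewrite ltr0n ltnW.
have xn0 : 0 < x ^+ n by rewrite exprn_gt0.
pose w k : R := (stirling2 n k)%:R * falling x k.
have w0 k : 0 <= w k by rewrite mulr_ge0// falling_nat_ge0.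
have n1 : 0 < 2 * n.+1%:R :> R by rewrite mulr_gt0.
have d2 : 0 < delta ^+ 2 by rewrite exprn_gt0.
suff [k kn [dk wk]] : exists2 k, (k <= n)%N &
    `|k%:R - (x - mu)| <= delta /\ x ^+ n <= 2 * n.+1%:R * w k.
  exists k; split => //; rewrite leqNgt; apply/negP => mk.
  by move: wk; rewrite /w /x falling_nat_small// !mulr0 leNgt xn0.
apply: contrapT => H.
(* If no such [k] exists, each weight is strictly below the pigeonhole share plus its Chebyshev
   contribution; summing makes the total mass smaller than itself. *)
have wlt (k : 'I_n.+1) : w k <
    x ^+ n / (2 * n.+1%:R) + w k * (x - k%:R - mu) ^+ 2 / delta ^+ 2.
  have [dk|dk] := leP `|k%:R - (x - mu)| delta.
    have [wk|wk] := leP (x ^+ n) (2 * n.+1%:R * w k).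
      by case: H; exists k => //; rewrite -ltnS.
    rewrite (@lt_le_trans _ _ (x ^+ n / (2 * n.+1%:R)))//.
      by rewrite ltr_pdivlMr// mulrC.
    by rewrite lerDl divr_ge0 ?(ltW d2)// mulr_ge0// sqr_ge0.
  rewrite (@le_lt_trans _ _ (w k * (x - k%:R - mu) ^+ 2 / delta ^+ 2))//.
    rewrite -mulrA ler_peMr// ler_pdivlMr// mul1r.
    rewrite -[leRHS]real_normK ?num_real// lerXn2r ?nnegrE ?(ltW d0)//.
    by rewrite (_ : x - _ - _ = - (k%:R - (x - mu))) ?normrN ?(ltW dk)//; ring.
  by rewrite ltrDr divr_gt0.
have : \sum_(k < n.+1) w k < \sum_(k < n.+1) (x ^+ n / (2 * n.+1%:R) +
    w k * (x - k%:R - mu) ^+ 2 / delta ^+ 2).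
  apply: ltr_sum => [|k _]; last exact: wlt.
  by apply/hasP; exists ord0; rewrite ?mem_index_enum.
rewrite big_split/= sumr_const card_ord -mulr_suml sum_stirling2_falling.
have -> : x ^+ n / (2 * n.+1%:R) *+ n.+1 = x ^+ n / 2.
  by rewrite -[LHS]mulr_natr; field; rewrite addrC natr1 pnatr_eq0.
apply/negP; rewrite -leNgt -lerBrDl.
rewrite ler_pdivrMr//; apply: le_trans (occupancy_variance m1) _.
rewrite (_ : _ - _ = x ^+ n / 2); last by field.
by rewrite mulrC -mulrA ler_wpM2l ?(ltW xn0)//; lra.
Qed.

End Occupancy.

                                      

(** * Exponents of the point masses *)

Section Exponents.
Variable R : realType.
Implicit Types (x s r theta : R) (n k m : nat).

                                                     
                                                                    
                                                              
(** The exponent, per unit of n, of (xn)_(sn) / (xn)^n, without its term -(1-s) ln n. *)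
Definition falling_exp x s : R := xlnx x - xlnx (x - s) - ln x.

(** The exponent, per unit of n, of (n!/k!) (e^r - 1)^k / r^n at k = sn, without its term (1-s) ln
    n, which cancels the one left out of [falling_exp]. *)
Definition stirling2_exp r s : R := - 1 - xlnx s + s * ln (expR r - 1) - ln r.

Definition stirling2_prob n theta k : R :=
  (stirling2 n k)%:R * falling theta k / theta ^+ n.

Lemma falling_exp_scale n x s : (0 < n)%N -> 0 < x -> s <= x ->
  xlnx (x * n%:R) - xlnx (x * n%:R - s * n%:R) - n%:R * ln (x * n%:R) =
  n%:R * falling_exp x s - n%:R * (1 - s) * ln n%:R.
Proof.
move=> n0 x0 sx; have N0 : 0 < n%:R :> R by rewrite ltr0n.
rewrite -mulrBl ![_ * n%:R]mulrC !xlnxM ?subr_ge0 ?(ltW x0)// lnM ?posrE//.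
by rewrite /falling_exp; ring.
Qed.

Lemma exprn_expR x n : 0 < x -> x ^+ n = expR (n%:R * ln x).
Proof. by move=> x0; rewrite expRM_natl lnK. Qed.

Variable vtheta : R.
Hypothesis vtheta1 : 1 <= vtheta.

Let vtheta0 : 0 < vtheta. Proof. exact: lt_le_trans vtheta1. Qed.

Let nat_le_theta n k : (k <= n)%N -> k%:R <= vtheta * n%:R.
Proof.
move=> kn; apply: (@le_trans _ _ n%:R); first by rewrite ler_nat.
by rewrite ler_peMl.
Qed.

Let ratioK n k : (0 < n)%N -> k%:R / n%:R * n%:R = k%:R :> R.
Proof. by move=> n0; rewrite divfK// pnatr_eq0 -lt0n. Qed.

Let ratio_le1 n k : (k <= n)%N -> k%:R / n%:R <= 1 :> R.
Proof.
case: n => [|n] kn; first by rewrite invr0 mulr0.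
by rewrite ler_pdivrMr// mul1r ler_nat.
Qed.

Let ratio_le n k : (k <= n)%N -> k%:R / n%:R <= vtheta.
Proof. by move=> kn; rewrite (le_trans (ratio_le1 kn)). Qed.

(** The endpoint t = 1 is treated apart: no saddle exists there, but S(n,n) = 1 is explicit. *)
Lemma stirling2_prob_nn_ge n : (0 < n)%N ->
  expR (n%:R * falling_exp vtheta 1) <= stirling2_prob n (vtheta * n%:R) n.
Proof.
move=> n0; have N0 : 0 < n%:R :> R by rewrite ltr0n.
have := @falling_exp_scale n vtheta 1 n0 vtheta0 vtheta1.
rewrite subrr mulr0 mul0r subr0 mul1r => <-.
rewrite /stirling2_prob stirling2_nn mul1r expRD expRN.
rewrite -exprn_expR ?mulr_gt0//.
rewrite ler_wpM2r ?invr_ge0 ?exprn_ge0 ?mulr_ge0 ?(ltW vtheta0)//.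
exact: falling_ge (nat_le_theta (leqnn n)).
Qed.

Lemma stirling2_prob_nn_le n : (0 < n)%N ->
  stirling2_prob n (vtheta * n%:R) n <=
  vtheta * n%:R * expR 1 * expR (n%:R * falling_exp vtheta 1).
Proof.
move=> n0; have N0 : 0 < n%:R :> R by rewrite ltr0n.
have := @falling_exp_scale n vtheta 1 n0 vtheta0 vtheta1.
rewrite subrr mulr0 mul0r subr0 mul1r => <-.
rewrite /stirling2_prob stirling2_nn mul1r expRD expRN.
rewrite -exprn_expR ?mulr_gt0// mulrA.
rewrite ler_wpM2r ?invr_ge0 ?exprn_ge0 ?mulr_ge0 ?(ltW vtheta0)//.
rewrite -mulrA -expRD falling_le// ?nat_le_theta//.
by rewrite (le_trans vtheta1)// ler_peMr ?(ltW vtheta0)// ler1n.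
Qed.

(** Change of parameter: the hypothesis bounds S(n,k) below by m^n / (m)_k up to a factor 2(n+1), so
    the mass at parameter vtheta n is controlled by a quotient of falling factorials. *)
Lemma stirling2_prob_ge n m k : (0 < n)%N -> (k <= n)%N -> (0 < m)%N ->
  (k <= m)%N ->
  (m%:R : R) ^+ n <= 2 * n.+1%:R * ((stirling2 n k)%:R * falling m%:R k) ->
  expR (n%:R * (falling_exp vtheta (k%:R / n%:R) -
    falling_exp (m%:R / n%:R) (k%:R / n%:R))) <=
  2 * n.+1%:R * m%:R * expR 1 * stirling2_prob n (vtheta * n%:R) k.
Proof.
move=> n0 kn m0 km h; have N0 : 0 < n%:R :> R by rewrite ltr0n.
have M0 : 0 < m%:R :> R by rewrite ltr0n.
have := @falling_exp_scale n vtheta (k%:R / n%:R) n0 vtheta0 (ratio_le kn).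
have := @falling_exp_scale n (m%:R / n%:R) (k%:R / n%:R) n0.
rewrite divr_gt0// ler_pM2r ?invr_gt0// ler_nat => /(_ isT km).
rewrite !ratioK// => em et.
have {em et} -> : n%:R * (falling_exp vtheta (k%:R / n%:R) -
    falling_exp (m%:R / n%:R) (k%:R / n%:R)) =
  (xlnx (vtheta * n%:R) - xlnx (vtheta * n%:R - k%:R)) -
  n%:R * ln (vtheta * n%:R) + n%:R * ln m%:R - (xlnx m%:R - xlnx (m%:R - k%:R)).
  by rewrite mulrBr; lra.
rewrite 3!expRD !expRN -!exprn_expR ?mulr_gt0//.
have fm := @falling_le R m%:R k; rewrite ler1n ler_nat in fm.
have {}fm := fm m0 km; have ft := falling_ge (nat_le_theta kn).
have S0 : 0 <= (stirling2 n k)%:R :> R by [].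
rewrite ler_pdivrMr ?expR_gt0// /stirling2_prob.
rewrite [leRHS](_ : _ = (2 * n.+1%:R * ((stirling2 n k)%:R * (m%:R *
  expR (1 + (xlnx m%:R - xlnx (m%:R - k%:R)))))) * (falling (vtheta * n%:R) k / 
  (vtheta * n%:R) ^+ n)); last (rewrite [in RHS]expRD; ring).
rewrite mulrC ler_pM ?exprn_ge0 ?divr_ge0 ?expR_ge0 ?mulr_ge0 ?(ltW vtheta0)//.
- by rewrite exprn_ge0// mulr_ge0// ltW.
- by apply: le_trans h _; rewrite ler_wpM2l// ler_wpM2l.
- by rewrite ler_wpM2r// invr_ge0 exprn_ge0// mulr_ge0// ltW.
Qed.

(** Combines [stirling2_egf_le] with the integral bounds for n!, k! and the falling factorial. The
    free [r] is optimized later. *)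
Lemma stirling2_prob_le n k r : 0 < r -> (0 < k <= n)%N ->
  stirling2_prob n (vtheta * n%:R) k <= vtheta * n%:R ^+ 2 * expR 2 *
    expR (n%:R * (stirling2_exp r (k%:R / n%:R) +
                  falling_exp vtheta (k%:R / n%:R))).
Proof.
move=> r0 /andP[k0 kn]; have n0 := leq_trans k0 kn.
have N0 : 0 < n%:R :> R by rewrite ltr0n.
have K0 : 0 < k%:R :> R by rewrite ltr0n.
have E0 : 0 < expR r - 1 by rewrite subr_gt0 -expR0 ltr_expR.
have := @falling_exp_scale n vtheta (k%:R / n%:R) n0 vtheta0 (ratio_le kn).
rewrite ratioK// => et.
have en : xlnx n%:R = n%:R * ln n%:R - n%:R :> R by [].
have ks : n%:R * (k%:R / n%:R) = k%:R :> R by rewrite mulrC ratioK.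
have ek : xlnx k%:R = n%:R * xlnx (k%:R / n%:R) + k%:R * ln n%:R :> R.
  by rewrite -[in LHS]ks xlnxM ?ks// divr_ge0.
have {et ek en} -> : n%:R * (stirling2_exp r (k%:R / n%:R) +
    falling_exp vtheta (k%:R / n%:R)) =
  (xlnx (vtheta * n%:R) - xlnx (vtheta * n%:R - k%:R)) -
  n%:R * ln (vtheta * n%:R) + xlnx n%:R - xlnx k%:R +
  k%:R * ln (expR r - 1) - n%:R * ln r.
  rewrite ek en et /stirling2_exp; set s := k%:R / n%:R in ks *.
  by rewrite -ks; ring.
have th0 : 0 < vtheta * n%:R by rewrite mulr_gt0.
rewrite !(expRB, expRD) -(exprn_expR k E0) -(exprn_expR n r0).
rewrite -(exprn_expR n th0).
have S_le : (stirling2 n k)%:R <= n%:R * expR (1 + xlnx n%:R) /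
    expR (xlnx k%:R) * (expR r - 1) ^+ k / r ^+ n :> R.
  have := stirling2_egf_le n k (ltW r0).
  have kf : 0 < k`!%:R :> R by rewrite ltr0n fact_gt0.
  have nf : 0 < n`!%:R :> R by rewrite ltr0n fact_gt0.
  rewrite -ler_pdivlMr ?exprn_gt0// -ler_pdivlMr ?invr_gt0// invrK.
  rewrite -ler_pdivlMr// => /le_trans; apply.
  rewrite [leLHS](_ : _ = (n`!%:R / k`!%:R) * ((expR r - 1) ^+ k / r ^+ n)).
    rewrite -[leRHS]mulrA ler_wpM2r//.
      by rewrite divr_ge0// exprn_ge0// ltW.
    rewrite ler_pM ?invr_ge0//; first exact: fact_le.
    by rewrite lef_pV2 ?posrE ?expR_gt0// fact_ge.
  by ring.
have F_le : falling (vtheta * n%:R) k <= vtheta * n%:R *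
    expR (1 + (xlnx (vtheta * n%:R) - xlnx (vtheta * n%:R - k%:R))).
  rewrite falling_le ?nat_le_theta//.
  by rewrite (le_trans vtheta1)// ler_peMr ?(ltW vtheta0)// ler1n.
rewrite /stirling2_prob.
apply: (@le_trans _ _ (n%:R * expR (1 + xlnx n%:R) / expR (xlnx k%:R) *
    (expR r - 1) ^+ k / r ^+ n * (vtheta * n%:R *
    expR (1 + (xlnx (vtheta * n%:R) - xlnx (vtheta * n%:R - k%:R)))) /
    (vtheta * n%:R) ^+ n)).
  rewrite ler_wpM2r ?invr_ge0 ?exprn_ge0 ?mulr_ge0 ?(ltW vtheta0)//.
  by rewrite ler_pM// falling_ge0// nat_le_theta.
rewrite !(expRB, expRD) le_eqVlt; apply/orP; left; apply/eqP.
by ring.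
Qed.

End Exponents.

                                                  

(** * The saddle equation and the Lambert function *)

Section Lambert.
Variable R : realType.
Implicit Types (a b t w x theta : R).

Lemma mulr_expR_lt a b : - 1 < a -> a < b -> a * expR a < b * expR b.
Proof.
move=> a1 ab; rewrite -ltr_pdivrMr ?expR_gt0// -mulrA -expRN -expRD.
have d := expR_ge1Dx (b - a); have d' := expR_ge1Dx (a - b).
have e : expR (b - a) * expR (a - b) = 1.
  by rewrite -expRD addrC addrA subrK subrr expR0.
have e0 := expR_gt0 (b - a); have e0' := expR_gt0 (a - b).
have [b0|b0] := leP 0 b.
  by nra.
by nra.
Qed.

Lemma lambertW0K w : - 1 < w -> lambertW0 (w * expR w) = w.
Proof.
move=> w1; rewrite /lambertW0; apply: (@pinvKV _ _ _ _ (fun w => w * expR w)).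
  move=> a b /set_mem/= a1 /set_mem/= b1 ab; apply/eqP; rewrite eq_le.
  apply/andP; split; rewrite leNgt; apply/negP => /mulr_expR_lt;
    rewrite ab ltxx.
    by move/(_ b1).
  by move/(_ a1).
by rewrite inE.
Qed.

Lemma exists_lambert x : 0 < x -> exists2 w, 0 < w & x = expR (- w) / w.
Proof.
move=> x0; have xV : 0 < x^-1 by rewrite invr_gt0.
have [|||w] := @IVT R (fun w => w * expR w) 0 x^-1 x^-1.
- exact: ltW.
- apply: continuous_subspaceT => w; apply: cvgM => //.
  exact: continuous_expR.
- have h : x^-1 <= x^-1 * expR x^-1.
    by rewrite ler_peMr ?(ltW xV)// -expR0 ler_expR ltW.
  by rewrite mul0r ge_min (ltW xV)/= le_max h orbT.
rewrite in_itv/= => /andP[w0 _] wx; have {}w0 : 0 < w.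
  rewrite lt_neqAle w0 andbT; apply/eqP => w00.
  by move: xV; rewrite -wx -w00 mul0r ltxx.
by exists w => //; rewrite -[LHS]invrK -wx invfM expRN mulrC.
Qed.

                                                              
(** The equation making r = w stationary for [stirling2_exp r t]. Equivalently, n balls in n/w boxes
    occupy about tn boxes. *)
Definition saddle t w := 0 < w /\ 1 - expR (- w) = t * w.

Lemma saddle_gt0 t w : saddle t w -> 0 < t.
Proof.
move=> [w0 tw]; rewrite -(pmulr_lgt0 _ w0) -tw subr_gt0.
by rewrite -expR0 ltr_expR oppr_lt0.
Qed.

Lemma exists_saddle t : 0 < t < 1 -> exists w, saddle t w.
Proof.
move=> /andP[t0 t1].
have t1V : 1 < t^-1 by rewrite invf_gt1.
have tt : t * t^-1 = 1 by rewrite divff ?gt_eqF.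
pose f w := 1 - expR (- w) - t * w.
have cf : continuous f.
  move=> w; apply: cvgB; last by apply: cvgM => //; exact: cvg_cst.
  apply: cvgB; first exact: cvg_cst.
  by apply: continuous_comp; [exact: opp_continuous|exact: continuous_expR].
(* The lower endpoint 1/t - 1 is positive, which excludes the trivial root 0; the sign there comes
   from e^y >= 1 + y. *)
have [|||w] := @IVT R f (t^-1 - 1) t^-1 0.
- by lra.
- exact: continuous_subspaceT.
- have f1 : 0 <= f (t^-1 - 1).
    have := expR_ge1Dx (t^-1 - 1); rewrite addrC subrK => h.
    have : expR (- (t^-1 - 1)) <= t.
      by rewrite expRN -[leRHS]invrK lef_pV2 ?posrE ?expR_gt0 ?invr_gt0.
    by rewrite /f mulrBr tt; lra.
  have f2 : f t^-1 <= 0.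
    by rewrite /f tt; have := expR_gt0 (- t^-1); lra.
  by rewrite ge_min f2 orbT le_max f1.
rewrite in_itv/= => /andP[w0 _] fw; exists w; split; first by lra.
by apply/eqP; rewrite -subr_eq0; apply/eqP.
Qed.

(** The saddle equation rewrites as z e^z = -e^(-1/t)/t with z = w - 1/t. The solution z = -1/t
    belongs to the other branch; here z > -1 because e^(-w) (1 + w) < 1. *)
Lemma saddle_lambertW0 t w : saddle t w ->
  lambertW0 (- t^-1 * expR (- (1 / t))) = w - t^-1.
Proof.
move=> tw; have t0 := saddle_gt0 tw; case: tw => w0 tw.
have tt : t * t^-1 = 1 by rewrite divff ?gt_eqF.
have ww : expR w * expR (- w) = 1 by rewrite -expRD subrr expR0.
have -> : - t^-1 * expR (- (1 / t)) = (w - t^-1) * expR (w - t^-1).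
  rewrite expRD div1r mulrA; congr (_ * _).
  have -> : w - t^-1 = - (t^-1 * expR (- w)).
    have -> : expR (- w) = 1 - t * w by rewrite -tw; ring.
    by rewrite mulrBr mulr1 mulrA (mulrC _ t) tt; ring.
  by rewrite mulNr -mulrA (mulrC (expR (- w))) ww mulr1.
have e1 : expR (- w) * (1 + w) < 1.
  by rewrite -[ltRHS]ww mulrC ltr_pM2r ?expR_gt0// expR_gt1Dx// gt_eqF.
have et : expR (- w) < t by rewrite -(ltr_pM2r w0) -tw; lra.
have : t^-1 < 1 + w by rewrite -(ltr_pM2l t0) tt mulrDr mulr1 -tw; lra.
by move=> h; apply: lambertW0K; lra.
Qed.

Lemma saddle_uniq t w w' : saddle t w -> saddle t w' -> w = w'.
Proof.
by move=> /saddle_lambertW0 + /saddle_lambertW0 => -> /(can_inj (subrK _)).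
Qed.

Lemma mu2_saddle t w : saddle t w -> mu2 (expR (- w) / w) = t.
Proof.
move=> [w0 tw]; rewrite /mu2 !div1r invfM invrK -expRN opprK mulrC.
rewrite lambertW0K; last by rewrite (lt_trans _ w0).
have -> : t = (1 - expR (- w)) / w by rewrite tw mulfK ?gt_eqF.
by rewrite mulrBl mul1r.
Qed.

(** Inverting [mu2] needs its injectivity: writing x = e^(-w)/w, [mu2] becomes (1 - e^(-w))/w, and
    [saddle_uniq] recovers w from that value. *)
Lemma mu2_inv_saddle t w : saddle t w -> mu2_inv t = expR (- w) / w.
Proof.
move=> tw; rewrite -[in LHS](mu2_saddle tw) /mu2_inv.
apply: (@pinvKV _ _ _ _ (@mu2 R)); last first.
  by case: tw => w0 _; rewrite inE/= divr_gt0 ?expR_gt0.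
move=> x y /set_mem/= x0 /set_mem/= y0.
have [u u0 ->] := exists_lambert x0; have [v v0 ->] := exists_lambert y0.
have sa z : 0 < z -> saddle ((1 - expR (- z)) / z) z.
  by move=> z0; split; rewrite // divfK ?gt_eqF.
rewrite (mu2_saddle (sa _ u0)) (mu2_saddle (sa _ v0)) => uv.
by have := sa _ v0; rewrite -uv => /(saddle_uniq (sa _ u0)) ->.
Qed.

Lemma saddle_mu2_inv t : 0 < t < 1 ->
  mu2_inv t = t / (1 + t * lambertW0 (- t^-1 * expR (- (1 / t)))) - t.
Proof.
move=> t01; have [w tw] := exists_saddle t01.
rewrite (mu2_inv_saddle tw) (saddle_lambertW0 tw).
have t0 := saddle_gt0 tw; case: tw => w0 tw.
have -> : expR (- w) = 1 - t * w by rewrite -tw; ring.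
have tN0 : t != 0 by rewrite gt_eqF.
have wN0 : w != 0 by rewrite gt_eqF.
have -> : 1 + t * (w - t^-1) = t * w by field.
by field; rewrite ?tN0 ?wN0.
Qed.

Let ln_saddle t w : saddle t w -> ln (w^-1 - t) = - w - ln w.
Proof.
move=> [w0 tw]; have -> : w^-1 - t = expR (- w) / w.
  have -> : expR (- w) = 1 - t * w by rewrite -tw; ring.
  by field; rewrite gt_eqF.
by rewrite ln_div ?posrE ?expR_gt0// expRK.
Qed.

Lemma stirling2_exp_saddle t w : saddle t w ->
  stirling2_exp w t = - 1 + t + t * w + t * ln w - ln w.
Proof.
move=> tw; have t0 := saddle_gt0 tw; case: tw => w0 tw.
rewrite /stirling2_exp /xlnx.
have -> : expR w - 1 = expR w * (t * w).
  by rewrite -tw mulrBr mulr1 -expRD subrr expR0.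
rewrite !lnM ?posrE ?mulr_gt0 ?expR_gt0// expRK; ring.
Qed.

(** The point where the two bounds meet: the Stirling exponent from the occupancy problem with n/w
    boxes equals the one from the generating function at r = w. *)
Lemma falling_exp_saddle t w : saddle t w ->
  falling_exp w^-1 t = - stirling2_exp w t.
Proof.
move=> tw; rewrite (stirling2_exp_saddle tw) /falling_exp /xlnx (ln_saddle tw).
by case: tw => w0 tw; rewrite lnV ?posrE//; field; rewrite gt_eqF.
Qed.

Lemma I3_saddle theta t w : 0 < t < 1 -> saddle t w ->
  I3 theta t = (- (stirling2_exp w t + falling_exp theta t))%:E.
Proof.
move=> t01 tw; rewrite /I3 t01 (stirling2_exp_saddle tw) (mu2_inv_saddle tw).
have -> : expR (- w) / w = w^-1 - t.
  case: tw => w0 tw.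
  have -> : expR (- w) = 1 - t * w by rewrite -tw; ring.
  by field; rewrite gt_eqF.
rewrite (ln_saddle tw) (_ : t + (w^-1 - t) = w^-1); last by ring.
rewrite div1r invrK /falling_exp /xlnx; congr (_%:E); ring.
Qed.

Lemma I3_1 theta : I3 theta 1 = (- falling_exp theta 1)%:E.
Proof.
rewrite /I3 ltxx andbF eqxx /falling_exp /xlnx; congr (_%:E); ring.
Qed.

End Lambert.

                    

(** * Limits: polynomial factors, continuity, vacant boxes *)

Section Limits.
Variable R : realType.

Lemma cvg_natV : (n%:R^-1 : R) @[n --> \oo] --> 0.
Proof.
apply/(@gtr0_cvgV0 R nat \oo _ (fun n => n%:R)); last exact: cvgr_idn.
by exists 1%N => // n /= n0; rewrite ltr0n.
Qed.

Lemma ln_le_sqrt (x : R) : 0 < x -> ln x <= 2 * Num.sqrt x.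
Proof.
move=> x0; have s0 : 0 < Num.sqrt x by rewrite sqrtr_gt0.
rewrite -[in ln x](sqr_sqrtr (ltW x0)) lnXn// mulr2n.
by have := ln_sublinear s0; lra.
Qed.

Lemma cvg_ln_nat : (ln n%:R / n%:R : R) @[n --> \oo] --> 0.
Proof.
apply: (@squeeze_cvgr _ _ _ _ (fun=> 0) (fun n => 2 * Num.sqrt n%:R^-1)).
- exists 1%N => // n /= n0; have N0 : 0 < n%:R :> R by rewrite ltr0n.
  rewrite divr_ge0 ?ln_ge0 ?ler1n//= ler_pdivrMr//.
  apply: le_trans (ln_le_sqrt N0) _; rewrite -mulrA ler_wpM2l// sqrtrV ?ler0n//.
  rewrite -[X in _ <= _ * X](sqr_sqrtr (ltW N0)) expr2 mulKf//.
  by rewrite gt_eqF// sqrtr_gt0.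
- exact: cvg_cst.
- rewrite (_ : 0 = 2 * Num.sqrt 0 :> R); last by rewrite sqrtr0 mulr0.
  apply: cvgM; first exact: cvg_cst.
  apply: (continuous_cvg _ _ cvg_natV); exact: sqrt_continuous.
Qed.

Lemma cvg_ln_poly (K : R) j : 0 < K ->
  (ln (K * n%:R ^+ j) / n%:R) @[n --> \oo] --> 0.
Proof.
move=> K0; apply: (@cvg_trans _
    ((ln K * n%:R^-1 + j%:R * (ln n%:R / n%:R)) @[n --> \oo])).
  apply: near_eq_cvg; exists 1%N => // n /= n0.
  have N0 : 0 < n%:R :> R by rewrite ltr0n.
  rewrite lnM ?posrE ?exprn_gt0// lnXn// -mulr_natl; ring.
rewrite (_ : 0 = ln K * 0 + j%:R * 0 :> R); last by rewrite !mulr0 addr0.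
apply: cvgD; apply: cvgM; try exact: cvg_cst; first exact: cvg_natV.
exact: cvg_ln_nat.
Qed.

(** At 0 from the right, |y ln y| <= 2 sqrt y; on the left the library's ln vanishes. Continuity at
    0 is needed when the argument vtheta - t reaches 0. *)
Lemma continuous_xlnx : continuous (@xlnx R).
Proof.
move=> x; apply: cvgB => //.
have [x0|x0|->] := ltgtP x 0.
- rewrite ln0 ?(ltW x0)// mulr0.
  have : (0 : R) @[y --> x] --> (0 : R) by exact: cvg_cst.
  apply: cvg_trans; apply: near_eq_cvg; near=> y.
  by rewrite ln0 ?mulr0// ltW//; near: y; exact: lt_nbhsl.
- by apply: cvgM => //; exact: continuous_ln.
rewrite mul0r; apply: norm_cvg0.
have sE : 2 * Num.sqrt `|y| @[y --> (0 : R)] --> (0 : R).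
  have : 2 * Num.sqrt `|y| @[y --> (0 : R)] --> 2 * Num.sqrt `|0 : R|.
    apply: cvgM; first exact: cvg_cst.
    apply: continuous_cvg; first exact: sqrt_continuous.
    exact: norm_continuous.
  by rewrite normr0 sqrtr0 mulr0.
apply: (squeeze_cvgr _ (cvg_cst 0) sE).
near=> y; rewrite normr_ge0 andTb.
have [y0|y0] := leP y 0; first by rewrite ln0// mulr0 normr0 mulr_ge0.
have y1 : y <= 1 by apply: ltW; near: y; exact: lt_nbhsl.
have yV : 0 < y^-1 by rewrite invr_gt0.
rewrite ler0_norm ?mulr_ge0_le0 ?(ltW y0)//; last exact: ln_le0.
have -> : `|y| = y by rewrite ger0_norm// ltW.
have := ln_le_sqrt yV; rewrite lnV// sqrtrV ?(ltW y0)// -mulrN => h.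
apply: le_trans (ler_wpM2l (ltW y0) h) _.
have s0 : 0 < Num.sqrt y by rewrite sqrtr_gt0.
by rewrite -{1}(sqr_sqrtr (ltW y0)) mulrCA expr2 mulfK ?gt_eqF.
Unshelve. all: by end_near. Qed.

Variables (rho : R).
Hypothesis rho0 : 0 < rho.

                                                     
(** The offset 2 guarantees at least two boxes for every [n], so that the variance bound applies and
    ln(m-1) has a positive argument. *)
Definition nb_boxes n : nat := (Num.trunc (rho * n%:R)).+2.

Lemma nb_boxes_itv n : rho * n%:R < (nb_boxes n)%:R <= rho * n%:R + 2.
Proof.
have /truncn_itv/andP[h1 h2] : 0 <= rho * n%:R by rewrite mulr_ge0// ltW.
rewrite /nb_boxes (lt_trans h2) ?ltr_nat//=.
by rewrite -addn2 natrD lerD2r.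
Qed.

Lemma cvg_nb_boxes : ((nb_boxes n)%:R / n%:R) @[n --> \oo] --> rho.
Proof.
apply: (@squeeze_cvgr _ _ _ _ (fun=> rho) (fun n => rho + 2 * n%:R^-1)).
- exists 1%N => // n /= n0; have N0 : 0 < n%:R :> R by rewrite ltr0n.
  have /andP[h1 h2] := nb_boxes_itv n.
  rewrite ler_pdivlMr// ler_pdivrMr// (ltW h1)/= mulrDl.
  by rewrite divfK// gt_eqF.
- exact: cvg_cst.
- have : (rho + 2 * n%:R^-1) @[n --> \oo] --> rho + 2 * 0.
    by apply: cvgD; [|apply: cvgM; [|exact: cvg_natV]]; exact: cvg_cst.
  by rewrite mulr0 addr0.
Qed.

(** The limit of (1 - 1/m)^n with m close to rho n: its logarithm lies between -n/(m-1) and -n/m by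
    [ln_sub_le]. *)
Lemma cvg_vacant :
  (((nb_boxes n)%:R - 1) ^+ n / (nb_boxes n)%:R ^+ n) @[n --> \oo] -->
  expR (- rho^-1).
Proof.
pose m n : R := (nb_boxes n)%:R.
have m2 n : 2 <= m n by rewrite ler_nat.
have m0 n : 0 < m n by rewrite (lt_le_trans _ (m2 n)).
have m1 n : 0 < m n - 1 by rewrite subr_gt0 (lt_le_trans _ (m2 n))// ltr1n.
apply: (@cvg_trans _ (expR (n%:R * (ln (m n - 1) - ln (m n))) @[n --> \oo])).
  apply: near_eq_cvg; near=> n.
  by rewrite mulrBr expRB -!exprn_expR.
apply: continuous_cvg; first exact: continuous_expR.
apply: (@squeeze_cvgr _ _ _ _ (fun n => - ((m n - 1) / n%:R)^-1)
    (fun n => - (m n / n%:R)^-1)).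
- exists 1%N => // n /= n0; have N0 : 0 < n%:R :> R by rewrite ltr0n.
  rewrite !invfM !invrK -!mulNr !(mulrC _ n%:R) !ler_pM2l//.
  apply/andP; split.
    have := ln_sub_le (m1 n) (m0 n).
    by rewrite -ler_pdivlMl//; lra.
  have := ln_sub_le (m0 n) (m1 n).
  by rewrite -ler_pdivlMl//; lra.
- apply: cvgN; apply: cvgV; first by rewrite gt_eqF.
  have : (m n / n%:R - n%:R^-1) @[n --> \oo] --> rho - 0.
    by apply: cvgB; [exact: cvg_nb_boxes|exact: cvg_natV].
  rewrite subr0; apply: cvg_trans; apply: near_eq_cvg; near=> n.
  by rewrite mulrBl mul1r.
- by apply: cvgN; apply: cvgV; [rewrite gt_eqF|exact: cvg_nb_boxes].
Unshelve. all: by end_near. Qed.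

End Limits.

(** * Lower bound along a sequence of typical atoms *)

Section LowerBound.
Variables (R : realType) (vtheta : R).
Hypothesis vtheta1 : 1 <= vtheta.

Lemma cvg_falling_exp (x s : R^nat) (x0 s0 : R) : 0 < x0 ->
  x n @[n --> \oo] --> x0 -> s n @[n --> \oo] --> s0 ->
  falling_exp (x n) (s n) @[n --> \oo] --> falling_exp x0 s0.
Proof.
move=> x00 cx cs; apply: cvgB.
  apply: cvgB; apply: continuous_cvg => //; try exact: continuous_xlnx.
  exact: cvgB.
by apply: continuous_cvg => //; exact: continuous_ln.
Qed.

Lemma stirling2_prob_ge0 n k : (k <= n)%N ->
  0 <= stirling2_prob n (vtheta * n%:R) k.
Proof.
move=> kn; have nt : n%:R <= vtheta * n%:R by rewrite ler_peMl.
rewrite /stirling2_prob divr_ge0 ?exprn_ge0//; last exact: le_trans nt.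
by rewrite mulr_ge0// falling_ge0// (le_trans _ nt)// ler_nat.
Qed.

(** Throw n balls into about n/w boxes and let [k n] be the typical value from [occupancy_typical];
    its deviation of order sqrt n disappears after division by n. *)
Lemma stirling2_prob_lower t w : t < 1 -> saddle t w ->
  exists (k : nat -> nat) (u : R^nat), [/\ forall n, (k n <= n)%N,
    (k n)%:R / n%:R @[n --> \oo] --> t,
    u n @[n --> \oo] --> stirling2_exp w t + falling_exp vtheta t &
    forall n, (0 < n)%N ->
      expR (n%:R * u n) <= stirling2_prob n (vtheta * n%:R) (k n)].
Proof.
move=> t1 tw; have t0 := saddle_gt0 tw; have [w0 twE] := tw.
pose rho := w^-1; have rho0 : 0 < rho by rewrite invr_gt0.
have trho : t < rho.
  by rewrite -(ltr_pM2r w0) mulVf ?gt_eqF// -twE ltrBlDr ltrDl expR_gt0.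
pose m n := nb_boxes rho n; pose mu n : R :=
  (m n)%:R * ((m n)%:R - 1) ^+ n / (m n)%:R ^+ n.
have m0 n : 0 < (m n)%:R :> R by rewrite ltr0n.
have /choice[k kP] (n : nat) : exists k, [/\ (k <= n)%N, (k <= m n)%N,
    `|k%:R - ((m n)%:R - mu n)| <= Num.sqrt (2 * (m n)%:R) &
    (m n)%:R ^+ n <=
      2 * n.+1%:R * ((stirling2 n k)%:R * falling (m n)%:R k) :> R].
  apply: occupancy_typical => //; first by rewrite sqrtr_gt0 mulr_gt0.
  by rewrite sqr_sqrtr// mulr_ge0.
have ck : (k n)%:R / n%:R @[n --> \oo] --> t.
  pose c n : R := (m n)%:R / n%:R -
    (m n)%:R / n%:R * (((m n)%:R - 1) ^+ n / (m n)%:R ^+ n).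
  have cc : c n @[n --> \oo] --> t.
    (* The saddle equation read as the limiting mean occupancy with rho = 1/w. *)
    have -> : t = rho - rho * expR (- rho^-1).
      rewrite /rho invrK -[X in X - _]mulr1 -mulrBr twE mulrC mulfK//.
      by rewrite gt_eqF.
    apply: cvgB; [|apply: cvgM]; [exact: cvg_nb_boxes..|exact: cvg_vacant].
  pose d n : R := Num.sqrt (2 * (m n)%:R) / n%:R.
  have cd : d n @[n --> \oo] --> 0.
    have : Num.sqrt (2 * ((m n)%:R / n%:R) * n%:R^-1) @[n --> \oo] -->
        Num.sqrt (2 * rho * 0).
      apply: continuous_cvg; first exact: sqrt_continuous.
      apply: cvgM; last exact: cvg_natV.
      by apply: cvgM; [exact: cvg_cst|exact: cvg_nb_boxes].
    rewrite mulr0 sqrtr0; apply: cvg_trans; apply: near_eq_cvg.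
    exists 1%N => // n /= n0; have N0 : 0 < n%:R :> R by rewrite ltr0n.
    rewrite /d (_ : 2 * _ * _ = 2 * (m n)%:R * n%:R^-1 ^+ 2); last first.
      by field; rewrite gt_eqF.
    rewrite [LHS]sqrtrM ?mulr_ge0// sqrtr_sqr gtr0_norm// invr_gt0//.
  apply: (@squeeze_cvgr _ _ _ _ (fun n => c n - d n) (fun n => c n + d n)).
  - exists 1%N => // n /= n0; have N0 : 0 < n%:R :> R by rewrite ltr0n.
    have [_ _ + _] := kP n.
    rewrite -ler_distl => h.
    have -> : (k n)%:R / n%:R - c n = ((k n)%:R - ((m n)%:R - mu n)) / n%:R.
      by rewrite /c /mu; ring.
    by rewrite normrM [`|_^-1|]gtr0_norm ?invr_gt0// ler_pM2r ?invr_gt0.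
  - by rewrite -[t]subr0; exact: cvgB.
  - by rewrite -[t]addr0; exact: cvgD.
(* Chosen so that the prefactor 2(n+1) m e of [stirling2_prob_ge] is at most K n^2, using n+1 <= 2n
   and m <= (rho+2) n. *)
pose K := 4 * (rho + 2) * expR 1.
have K0 : 0 < K by rewrite mulr_gt0 ?expR_gt0// mulr_gt0// addr_gt0.
pose G n := falling_exp vtheta ((k n)%:R / n%:R) -
  falling_exp ((m n)%:R / n%:R) ((k n)%:R / n%:R).
exists k, (fun n => G n - ln (K * n%:R ^+ 2) / n%:R); split => //.
- by move=> n; have [] := kP n.
- rewrite -[stirling2_exp w t]opprK -falling_exp_saddle// addrC.
  rewrite -[_ - _ in X in _ --> X]subr0.
  apply: cvgB; last exact: cvg_ln_poly.
  apply: cvgB; apply: cvg_falling_exp => //.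
  + by rewrite (lt_le_trans ltr01).
  + exact: cvg_cst.
  + exact: cvg_nb_boxes.
move=> n n0; have N0 : 0 < n%:R :> R by rewrite ltr0n.
have [kn km _ h] := kP n.
have KN : 0 < K * n%:R ^+ 2 by rewrite mulr_gt0// exprn_gt0.
rewrite mulrBr mulrCA divff ?gt_eqF// mulr1 expRB lnK// ler_pdivrMr//.
apply: le_trans (stirling2_prob_ge vtheta1 n0 kn _ km h) _ => //.
rewrite mulrC ler_wpM2l ?stirling2_prob_ge0//.
rewrite /K [leRHS](_ : _ = 4 * (rho + 2) * n%:R ^+ 2 * expR 1); last by ring.
rewrite ler_wpM2r ?expR_ge0//.
rewrite (_ : 4 * _ * _ = (2 * (2 * n%:R)) * ((rho + 2) * n%:R)); last by ring.
rewrite ler_pM ?mulr_ge0//.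
  by rewrite ler_wpM2l// -natr1 mulr2n mulrDl !mul1r lerD2l ler1n.
have /andP[_ /le_trans] := nb_boxes_itv rho0 n; apply.
by rewrite mulrDl lerD2l ler_peMr// ler1n.
Qed.

End LowerBound.

                          

(** * The rate function *)

Section Rate.
Variables (R : realType) (vtheta : R).
Hypothesis vtheta1 : 1 <= vtheta.

Let vtheta0 : 0 < vtheta. Proof. exact: lt_le_trans vtheta1. Qed.

Lemma stirling2_prob_sum1 n : (0 < n)%N ->
  \sum_(i < n) stirling2_prob n (vtheta * n%:R) i.+1 = 1.
Proof.
case: n => // n _; rewrite /stirling2_prob -mulr_suml.
have := sum_stirling2_falling (vtheta * n.+1%:R) n.+1.
rewrite big_ord_recl stirling2_n0 mul0r add0r => ->.
by rewrite divff// expf_neq0// mulf_neq0 ?gt_eqF// ltr0n.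
Qed.

Lemma stirling2_prob_le1 n k : (0 < n)%N -> (k < n)%N ->
  stirling2_prob n (vtheta * n%:R) k.+1 <= 1.
Proof.
move=> n0 kn; rewrite -[leRHS](stirling2_prob_sum1 n0) (bigD1 (Ordinal kn))//=.
by rewrite lerDl sumr_ge0// => i _; rewrite stirling2_prob_ge0.
Qed.

Lemma I3_lower t : 0 < t <= 1 -> exists (k : nat -> nat) (u : R^nat) (L : R),
  [/\ I3 vtheta t = (- L)%:E, u n @[n --> \oo] --> L,
    (k n)%:R / n%:R @[n --> \oo] --> t,
    \forall n \near \oo, (0 < k n <= n)%N &
    \forall n \near \oo,
      expR (n%:R * u n) <= stirling2_prob n (vtheta * n%:R) (k n)].
Proof.
move=> /andP[t0]; rewrite le_eqVlt => /predU1P[->|t1].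
  exists id, (fun=> falling_exp vtheta 1), (falling_exp vtheta 1); split.
  - by rewrite I3_1.
  - exact: cvg_cst.
  - have : (1 : R) @[n --> \oo] --> (1 : R) by exact: cvg_cst.
    apply: cvg_trans; apply: near_eq_cvg; exists 1%N => // n /= n0.
    by rewrite divff// pnatr_eq0 -lt0n.
  - by exists 1%N => // n /= n0; rewrite n0 /=.
  - by exists 1%N => // n /= n0; exact: stirling2_prob_nn_ge.
have t01 : 0 < t < 1 by rewrite t0.
have [w tw] := exists_saddle t01.
have [k [u [kn ck cu h]]] := stirling2_prob_lower vtheta1 t1 tw.
exists k, u, (stirling2_exp w t + falling_exp vtheta t); split => //.
- exact: I3_saddle.
- have k0 : \forall n \near \oo, 0 < (k n)%:R / n%:R :> R.
    exact: cvgr_gt ck _ t0.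
  near=> n; rewrite kn andbT lt0n; apply/eqP => kn0.
  suff : 0 < (k n)%:R / n%:R :> R by rewrite kn0 mul0r ltxx.
  by near: n.
- by exists 1%N => // n /= n0; exact: h.
Unshelve. all: by end_near. Qed.

Lemma I3_out t : ~~ (0 < t <= 1) -> I3 vtheta t = +oo%E.
Proof.
move=> tN; rewrite /I3; have [t01|_] := boolP (0 < t < 1).
  by move: tN; case/andP: t01 => -> /ltW ->.
by case: eqP => // t1; move: tN; rewrite t1 ltr01 lexx.
Qed.

(** Probabilities are at most 1, so the exponents [u n] of the lower bound are eventually
    nonpositive, and so is their limit. *)
Lemma I3_ge0 t : (0 <= I3 vtheta t)%E.
Proof.
have [t01|tN] := boolP (0 < t <= 1); last by rewrite I3_out// leey.
have [k [u [L [-> cu ck k0 h]]]] := I3_lower t01; rewrite lee_fin oppr_ge0.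
apply: (cvgr_to_le cu); near=> n.
have n0 : (0 < n)%N by near: n; exact: nbhs_infty_gt.
rewrite -(pmulr_rle0 _ (_ : 0 < n%:R)) ?ltr0n// -ler_expR expR0.
have kn : (0 < k n <= n)%N by near: n.
apply: (@le_trans _ _ (stirling2_prob n (vtheta * n%:R) (k n))).
  by near: n.
by case: (k n) kn => // j /= jn; exact: stirling2_prob_le1.
Unshelve. all: by end_near. Qed.

Lemma continuous_stirling2_exp r : continuous (@stirling2_exp R r).
Proof.
move=> s; apply: cvgB; last exact: cvg_cst.
apply: cvgD; last by apply: cvgM => //; exact: cvg_cst.
by apply: cvgB; [exact: cvg_cst|exact: continuous_xlnx].
Qed.

Lemma continuous_falling_exp : continuous (falling_exp vtheta).
Proof.
move=> s; apply: cvgB; last exact: cvg_cst.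
apply: cvgB; first exact: cvg_cst.
apply: (@continuous_comp _ _ _ (fun y => vtheta - y)); last first.
  exact: continuous_xlnx.
by apply: cvgB => //; exact: cvg_cst.
Qed.

(** Apply the lower bound and the upper bound with parameter [r] to the same atoms [k n], and
    compare exponents in the limit. This avoids proving by calculus that the saddle is a
    minimizer. *)
Lemma le_I3 t r : 0 < t <= 1 -> 0 < r ->
  ((- (stirling2_exp r t + falling_exp vtheta t))%:E <= I3 vtheta t)%E.
Proof.
move=> t01 r0; have [k [u [L [-> cu ck k0 h]]]] := I3_lower t01.
rewrite lee_fin lerN2; set K := vtheta * expR 2.
have K0 : 0 < K by rewrite mulr_gt0 ?expR_gt0.
pose s n : R := (k n)%:R / n%:R.
pose v n := ln (K * n%:R ^+ 2) / n%:R +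
  (stirling2_exp r (s n) + falling_exp vtheta (s n)).
have cv : v n @[n --> \oo] --> stirling2_exp r t + falling_exp vtheta t.
  rewrite -[X in _ --> X]add0r; apply: cvgD; first exact: cvg_ln_poly.
  apply: cvgD; apply: continuous_cvg => //.
    exact: continuous_stirling2_exp.
  exact: continuous_falling_exp.
apply: (ler_cvg_to cu cv); near=> n.
have n0 : (0 < n)%N by near: n; exact: nbhs_infty_gt.
have N0 : 0 < n%:R :> R by rewrite ltr0n.
have kn : (0 < k n <= n)%N by near: n.
rewrite -(ler_pM2l N0) -ler_expR.
apply: (@le_trans _ _ (stirling2_prob n (vtheta * n%:R) (k n))).
  by near: n.
apply: le_trans (stirling2_prob_le vtheta1 r0 kn) _.
rewrite [in leRHS]/v [in leRHS]mulrDr (mulrCA _ (ln _)) divff ?gt_eqF//.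
rewrite mulr1 [in leRHS]expRD.
rewrite lnK ?posrE ?mulr_gt0 ?exprn_gt0//.
by rewrite le_eqVlt; apply/orP; left; apply/eqP; rewrite /K; ring.
Unshelve. all: by end_near. Qed.

(** Off [0,1] the rate is infinite on a neighbourhood. On [0,1] it is the supremum over r > 0 of the
    continuous functions [phi r], so it suffices to find [r] with [phi r x] above [a]. *)
Lemma I3_lsc : lower_semicontinuous (I3 vtheta).
Proof.
move=> x a ax.
have [x0|x0] := ltP x 0.
  exists [set y | y < 0]; first exact: lt_nbhsl.
  by move=> y /= y0; rewrite I3_out ?ltry// lt_gtF.
have [x1|x1] := ltP 1 x.
  exists [set y | 1 < y]; first exact: lt_nbhsr.
  by move=> y /= y0; rewrite I3_out ?ltry// leNgt y0 andbF.
pose phi r y := - (stirling2_exp r y + falling_exp vtheta y).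
suff [r r0 ar] : exists2 r, 0 < r & a < phi r x.
  exists [set y | a < phi r y].
    have cphi : phi r y @[y --> x] --> phi r x.
      by apply: cvgN; apply: cvgD;
        [exact: continuous_stirling2_exp|exact: continuous_falling_exp].
    exact: cvgr_gt cphi _ ar.
  move=> y /= ay; have [y01|yN] := boolP (0 < y <= 1); last first.
    by rewrite I3_out ?ltry.
  by apply: lt_le_trans (le_I3 y01 r0); rewrite lte_fin.
                                                                           
(* At 0, [phi r] equals 1 + ln r minus a constant, which is unbounded in [r]; this choice gives the
   value a + 1. *)
move: x0; rewrite le_eqVlt => /predU1P[x0|x0].
  exists (expR (a + falling_exp vtheta 0)); first exact: expR_gt0.
  rewrite -x0 /phi /stirling2_exp xlnx0 mul0r expRK; lra.
move: x1; rewrite le_eqVlt => /predU1P[x1|x1].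
  move: ax; rewrite x1 I3_1 lte_fin => ax.
  (* At 1 the supremum is approached as r -> 0: since (e^r - 1)/r <= e^r, [phi r 1] is within [r] of
     the rate, and [r] is half the gap to [a]. *)
  pose r := (- falling_exp vtheta 1 - a) / 2.
  have r0 : 0 < r by rewrite divr_gt0// subr_gt0.
  exists r => //; rewrite /phi /stirling2_exp mul1r /xlnx ln1 mulr0.
  have : ln (expR r - 1) <= ln r + r.
    have E0 : 0 < expR r - 1 by rewrite subr_gt0 -expR0 ltr_expR.
    rewrite -ler_expR expRD !lnK ?posrE//.
    have := expR_ge1Dx (- r).
    rewrite -(ler_pM2r (expR_gt0 r)) -expRD addNr expR0; lra.
  by rewrite /r; lra.
have x01 : 0 < x < 1 by rewrite x0.
have [w xw] := exists_saddle x01; exists w; first by case: xw.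
by move: ax; rewrite (I3_saddle _ x01 xw) lte_fin.
Qed.

(** A real lower bound [j] stands in for the rate so that closed sets with infinite infimum are
    covered as well. *)
Lemma stirling2_prob_le_I3 n k (j : R) : (0 < k <= n)%N ->
  (j%:E <= I3 vtheta (k%:R / n%:R))%E ->
  stirling2_prob n (vtheta * n%:R) k <=
  vtheta * expR 2 * n%:R ^+ 2 * expR (- (n%:R * j)).
Proof.
move=> /andP[k0 kn] jI; have n0 := leq_trans k0 kn.
have N0 : 0 < n%:R :> R by rewrite ltr0n.
have h x : I3 vtheta (k%:R / n%:R) = (- x)%:E ->
    expR (n%:R * x) <= expR (- (n%:R * j)).
  by move: jI => /[swap] ->; rewrite lee_fin ler_expR -mulrN ler_pM2l// lerNr.
move: kn; rewrite leq_eqVlt => /predU1P[kn|kn].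
  move: h; rewrite kn divff ?gt_eqF// I3_1 => /(_ _ erefl) h.
  apply: le_trans (stirling2_prob_nn_le vtheta1 n0) _.
  rewrite ler_pM ?expR_ge0 ?mulr_ge0 ?expR_ge0 ?(ltW vtheta0)//.
  rewrite -!mulrA ler_pM2l// mulrC ler_pM ?expR_ge0//.
    by rewrite ler_expR ler1n.
  by rewrite expr2 ler_peMr ?(ltW N0)// ler1n.
have t01 : 0 < (k%:R / n%:R : R) < 1.
  by rewrite divr_gt0 ?ltr0n//= ltr_pdivrMr// mul1r ltr_nat.
have [w tw] := exists_saddle t01; have [w0 _] := tw.
have knn : (0 < k <= n)%N by rewrite k0 ltnW.
apply: le_trans (stirling2_prob_le vtheta1 w0 knn) _.
rewrite (mulrAC vtheta) ler_pM2l; last first.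
  by rewrite !mulr_gt0 ?expR_gt0 ?exprn_gt0.
exact/h/I3_saddle.
Qed.

End Rate.

                                       

(** * Extended-real limits and a bound from atoms *)

Section ErealLimits.
Variable R : realType.
Local Open Scope ereal_scope.

Lemma limn_esup_le_lim (u : (\bar R)^nat) (v : R^nat) (l : R) :
  v n @[n --> \oo] --> l -> (\forall n \near \oo, u n <= (v n)%:E) ->
  limn_esup u <= l%:E.
Proof.
move=> vl uv; apply/lee_addgt0Pr => e e0.
have le : (l < l + e)%R by rewrite ltrDl.
have vle : \forall n \near \oo, (v n < l + e)%R by exact: cvgr_lt vl _ le.
apply: (@le_trans _ _ (ereal_sup (u @` [set n | u n <= (l + e)%:E]))).
  apply: ereal_inf_lbound; exists [set n | u n <= (l + e)%:E] => //.
  near=> n; apply: (@le_trans _ _ (v n)%:E); first by near: n.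
  by rewrite lee_fin ltW//; near: n.
by apply: ge_ereal_sup => _ [n /= un <-].
Unshelve. all: by end_near. Qed.

Lemma limn_einf_ge_lim (u : (\bar R)^nat) (v : R^nat) (l : R) :
  v n @[n --> \oo] --> l -> (\forall n \near \oo, (v n)%:E <= u n) ->
  l%:E <= limn_einf u.
Proof.
move=> vl uv; rewrite /limn_einf leeNr -EFinN.
apply: (@limn_esup_le_lim _ (fun n => - v n)%R); first exact: cvgN.
by apply: filterS uv => n; rewrite EFinN leeN2.
Qed.

Lemma lne_scale_le (n : nat) (y : \bar R) (c : R) : (0 < n)%N -> (0 < c)%R ->
  y <= c%:E -> n%:R^-1%:E * lne y <= (ln c / n%:R)%:E.
Proof.
move=> n0 c0; have nV : (0 < n%:R^-1 :> R)%R by rewrite invr_gt0 ltr0n.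
have [y0|y0] := leP y 0.
  by rewrite le0_lneNy// gt0_muleNy ?lte_fin// leNye.
case: y y0 => [y| |]//; rewrite lte_fin lee_fin => y0 yc.
by rewrite lne_EFin// -EFinM lee_fin mulrC ler_pM2r// ler_ln.
Qed.

Lemma lne_scale_ge (n : nat) (y : \bar R) (x : R) : (0 < n)%N ->
  (expR (n%:R * x))%:E <= y -> x%:E <= n%:R^-1%:E * lne y.
Proof.
move=> n0; have nV : (0 < n%:R^-1 :> R)%R by rewrite invr_gt0 ltr0n.
case: y => [y| |]//; last by move=> _; rewrite /= gt0_muley ?lte_fin// leey.
rewrite lee_fin => h; have y0 : (0 < y)%R by exact: lt_le_trans (expR_gt0 _) h.
rewrite lne_EFin// -EFinM lee_fin mulrC ler_pdivlMr ?ltr0n//.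
by rewrite -ler_expR lnK// mulrC.
Qed.

End ErealLimits.

(** The events [E i] carry full mass. [B] is disjoint from those outside [C], so its probability is
    at most 1 minus theirs, which is the sum over [C]. *)
Lemma probability_le_sum d (T : measurableType d) (R : realType)
    (P : probability T R) n (E : 'I_n -> set T) (p : 'I_n -> R) (B : set T)
    (C : pred 'I_n) :
  (forall i, measurable (E i)) -> trivIset setT E ->
  (forall i, P (E i) = (p i)%:E) -> \sum_i p i = 1 ->
  measurable B -> (forall i, ~~ C i -> B `&` E i = set0) ->
  (P B <= (\sum_(i | C i) p i)%:E)%E.
Proof.
move=> mE tE PE p1 mB BE.
pose D := \big[setU/set0]_(i < n | ~~ C i) E i.
have mD : measurable D by apply: bigsetU_measurable.
have BD : B `&` D = set0.
  apply/seteqP; split => // x [Bx]; rewrite /D -bigcup_seq_cond.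
  by move=> [i /= /andP[_ /BE BEi]] Ex; have : (B `&` E i) x by []; rewrite BEi.
have PD : P D = (\sum_(i | ~~ C i) p i)%:E.
  rewrite /D measure_bigsetU_ord// -sumEFin.
  by apply: eq_bigr => i _; exact: PE.
have := @probability_le1 _ _ _ P (B `|` D) (measurableU _ _ mB mD).
have -> : P (B `|` D) = (P B + P D)%E by exact: measureU.
have -> : 1%E = (\sum_(i | C i) p i)%:E + (\sum_(i | ~~ C i) p i)%:E :> \bar R.
  by rewrite -EFinD -p1 (bigID C).
by rewrite PD leeD2rE.
Qed.

(** * The large deviations bounds *)

Section LDP.
Variables (R : realType) (vtheta : R).
Hypothesis vtheta1 : 1 <= vtheta.

(** Union bound over the at most n atoms lying in [F], each with prefactor n^2; hence n^3. *)
Lemma probability_upper d (T : measurableType d) (P : probability T R)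
    (X : {RV P >-> R}) n (F : set R) (j : R) : (0 < n)%N ->
  stirling2_law X n (vtheta * n%:R) -> closed F ->
  (forall t, F t -> (j%:E <= I3 vtheta t)%E) ->
  (distribution P (n%:R^-1 \o* X : {RV P >-> R}) F <=
   (vtheta * expR 2 * n%:R ^+ 3 * expR (- (n%:R * j)))%:E)%E.
Proof.
move=> n0 hX cF FI; have N0 : 0 < n%:R :> R by rewrite ltr0n.
pose C (i : 'I_n) := i.+1%:R / n%:R \in F.
apply: (@le_trans _ _
  (\sum_(i < n | C i) stirling2_prob n (vtheta * n%:R) i.+1)%:E).
  apply: (@probability_le_sum _ _ _ P n (fun i => X @^-1` [set i.+1%:R])).
  - by move=> i; exact: measurable_funPTI.
  - apply/trivIsetP => i i' _ _ ii'; apply/seteqP; split => // x [/= ->] /eqP.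
    by rewrite eqr_nat eqSS => /eqP e; case/eqP: ii'; exact/val_inj.
  - by move=> i; apply: hX; rewrite /= ltn_ord.
  - exact: stirling2_prob_sum1.
  - by apply: measurable_funPTI; exact: closed_measurable.
  - move=> i Ci; apply/seteqP; split => // x [/= + xi].
    by rewrite xi => Fi; case/negP: Ci; rewrite /C inE.
rewrite lee_fin; apply: (@le_trans _ _ (\sum_(i < n | C i)
    (vtheta * expR 2 * n%:R ^+ 2 * expR (- (n%:R * j))))).
  apply: ler_sum => i; rewrite /C inE => /FI.
  by apply: stirling2_prob_le_I3; rewrite ?ltn_ord.
have c0 : 0 <= vtheta * expR 2 * n%:R ^+ 2 * expR (- (n%:R * j)).
  by rewrite !mulr_ge0 ?expR_ge0 ?exprn_ge0// (le_trans _ vtheta1).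
rewrite [leLHS]big_mkcond/=; apply: (@le_trans _ _ (\sum_(i < n)
    (vtheta * expR 2 * n%:R ^+ 2 * expR (- (n%:R * j))))).
  by apply: ler_sum => i _; case: ifP.
rewrite sumr_const card_ord -[leLHS]mulr_natr le_eqVlt; apply/orP; left.
by apply/eqP; ring.
Qed.

Lemma probability_lower d (T : measurableType d) (P : probability T R)
    (X : {RV P >-> R}) n k (U : set R) : (0 < k <= n)%N ->
  stirling2_law X n (vtheta * n%:R) -> open U -> U (k%:R / n%:R) ->
  ((stirling2_prob n (vtheta * n%:R) k)%:E <=
   distribution P (n%:R^-1 \o* X : {RV P >-> R}) U)%E.
Proof.
move=> kn hX oU Uk; rewrite -[leLHS](hX k kn).
rewrite /distribution /pushforward; apply: le_measure; rewrite ?inE.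
- exact: measurable_funPTI.
- by apply: measurable_funPTI; exact: open_measurable.
- by move=> x /= xk; rewrite xk.
Qed.

Section Sequence.
Variables (d : nat -> measure_display) (T : forall n, measurableType (d n)).
Variables (P : forall n, probability (T n) R) (X : forall n, {RV (P n) >-> R}).
Hypothesis hX : forall n, (0 < n)%N -> stirling2_law (X n) n (vtheta * n%:R).

Let Y n : {RV (P n) >-> R} := n%:R^-1 \o* X n.

Lemma LDP_upper F : closed F ->
  (limn_esup (fun n => n%:R^-1%:E * lne (distribution (P n) (Y n) F)) <=
   - ereal_inf (I3 vtheta @` F))%E.
Proof.
move=> cF.
have up (j : R) : (j%:E <= ereal_inf (I3 vtheta @` F))%E ->
    (limn_esup (fun n => n%:R^-1%:E * lne (distribution (P n) (Y n) F)) <=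
     (- j)%:E)%E.
  move=> jI; set K := vtheta * expR 2.
  have K0 : 0 < K by rewrite mulr_gt0 ?expR_gt0// (lt_le_trans _ vtheta1).
  apply: (@limn_esup_le_lim _ _ (fun n => ln (K * n%:R ^+ 3) / n%:R - j)).
    rewrite -[X in _ --> X]add0r; apply: cvgB; last exact: cvg_cst.
    exact: cvg_ln_poly.
  exists 1%N => // n /= n0; have N0 : 0 < n%:R :> R by rewrite ltr0n.
  have KN : 0 < K * n%:R ^+ 3 by rewrite mulr_gt0// exprn_gt0.
  have -> : ln (K * n%:R ^+ 3) / n%:R - j =
      ln (K * n%:R ^+ 3 * expR (- (n%:R * j))) / n%:R.
    rewrite [in RHS]lnM ?posrE ?expR_gt0// expRK; field; exact: lt0r_neq0.
  apply: lne_scale_le => //; first by rewrite mulr_gt0// expR_gt0.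
  apply: probability_upper => //; first exact: hX.
  by move=> t Ft; apply: le_trans jI _; apply: ereal_inf_lbound; exists t.
(* For an infinite infimum every real [j] is admissible, which forces the limsup to be -oo. *)
case: (ereal_inf _) up => [r| |] up.
- by rewrite -EFinN; exact: up.
- rewrite /= (@eq_ninfty _ (limn_esup _))// => r.
  by rewrite -[r]opprK up// leey.
- by rewrite /= leey.
Qed.

(** For t in [U], the atoms (k n)/n of [I3_lower] converge to t and so eventually lie in [U]; one
    atom already gives the bound. *)
Lemma LDP_lower U : open U ->
  (- ereal_inf (I3 vtheta @` U) <=
   limn_einf (fun n => n%:R^-1%:E * lne (distribution (P n) (Y n) U)))%E.
Proof.
move=> oU; rewrite leeNl; apply: le_ereal_inf_tmp => _ [t Ut <-].
have [t01|tN] := boolP (0 < t <= 1); last by rewrite I3_out// leey.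
have [k [u [L [-> cu ck k0 h]]]] := I3_lower vtheta1 t01.
rewrite EFinN leeN2; apply: (limn_einf_ge_lim cu).
have Uk : \forall n \near \oo, U ((k n)%:R / n%:R).
  by apply: ck; exact: open_nbhs_nbhs.
near=> n; have n0 : (0 < n)%N by near: n; exact: nbhs_infty_gt.
apply: lne_scale_ge => //.
apply: (@le_trans _ _ (stirling2_prob n (vtheta * n%:R) (k n))%:E).
  by rewrite lee_fin; near: n.
by apply: probability_lower => //; [near: n|exact: hX|near: n].
Unshelve. all: by end_near. Qed.

End Sequence.
End LDP.

Theorem corollary2p12 (R : realType) (vtheta : R) (hvtheta : 1 <= vtheta)
    (d : nat -> measure_display) (T : forall n : nat, measurableType (d n))
    (P : forall n : nat, probability (T n) R)
    (X : forall n : nat, {RV (P n) >-> R})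
    (hX : forall n : nat, (0 < n)%N ->
       stirling2_law (X n) n (vtheta * n%:R)) :
  (forall t : R, 0 < t < 1 ->
     mu2_inv t = t / (1 + t * lambertW0 (- t^-1 * expR (- (1 / t)))) - t) /\
  satisfies_LDP (fun n : nat => (n%:R^-1 \o* X n : {RV (P n) >-> R}))
    (fun n : nat => n%:R) (I3 vtheta).
Proof.
split; first exact: saddle_mu2_inv.
split.
- by split; [exact: I3_ge0|exact: I3_lsc].
- exact: cvgr_idn.
- by move=> U oU; exact: LDP_lower.
- by move=> F cF; exact: LDP_upper.
Qed.
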